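(* Let $(n_i)_{i \ge 1}$ be a sequence of positive integers and let $B^{(i)} \subset \mathbb{R}^{n_i}$ be measurable sets. The sequence $(B^{(i)})$ is noise stable if and only if there exist $t>0$ and $\epsilon > 0$ such that, for all sufficiently large $i$, $M(B^{(i)}_{t,Y}) \ge \epsilon$ with probability at least $\epsilon$, where $Y \sim \gamma_{n_i}$.
   Context: $\gamma_n$ is the standard Gaussian measure on $\mathbb{R}^n$; $\mathbb{E}$, $\mathrm{Var}$, $\mathrm{Cov}$ of functions on $\mathbb{R}^n$ are taken with respect to $\gamma_n$. $P_t$ is the Ornstein-Uhlenbeck semigroup, $P_t f(x) = \mathbb{E} f(e^{-t} x + \sqrt{1-e^{-2t}}\, X)$ with $X \sim \gamma_n$. A sequence of sets $A_i \subset \mathbb{R}^{n_i}$ is noise sensitive if $\mathrm{Var}(P_t 1_{A_i}) \to 0$ as $i\to\infty$ for all $t>0$; otherwise the sequence is called noise stable. A half-space in $\mathbb{R}^n$ is a set of the form $\{x \in \mathbb{R}^n : \langle x, a\rangle \le b\}$ with $a \in \mathbb{R}^n$, $b \in \mathbb{R}$; $\mathcal{H}_n$ is the set of all half-spaces. For measurable $B \subset \mathbb{R}^n$, $M(B) = \sup_{A \in \mathcal{H}_n} \mathrm{Cov}(1_A, 1_B)$. For $B \subset \mathbb{R}^n$, $t \ge 0$ and $y \in \mathbb{R}^n$, $B_{t,y} = \{x \in \mathbb{R}^n : \sqrt{1-e^{-2t}}\, x + e^{-t} y \in B\}$.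
   Formalization: As stated false: alternating a half-line with the empty set is noise stable, but the condition fails at odd i. Proved instead: every subsequence is noise stable iff the condition holds for all large i, and the sequence is noise stable iff it holds for infinitely many i. *)

(* Defs.v *)
From HB Require Import structures.
From mathcomp Require Import all_boot all_order all_algebra.
From mathcomp Require Import all_classical all_reals all_analysis.

Set Implicit Arguments.
Unset Strict Implicit.
Unset Printing Implicit Defensive.

Import Order.TTheory GRing.Theory Num.Theory numFieldNormedType.Exports.

Local Open Scope classical_set_scope.
Local Open Scope ring_scope.

(* normal_prob lives on measurableTypeR R, whose measurable sets are those of R. *)
Definition tcons (R : realType) (n : nat)
    (p : measurableTypeR R * n.-tuple R) : n.+1.-tuple R :=
  [tuple of p.1 :: p.2].

Lemma measurable_tcons (R : realType) (n : nat) :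
  measurable_fun [set: measurableTypeR R * n.-tuple R] (@tcons R n).
Proof.
exact: (@measurable_cons _ _ _ R (fst : measurableTypeR R * n.-tuple R -> R)).
Qed.

HB.instance Definition _ (R : realType) (n : nat) :=
  isMeasurableFun.Build _ _ _ _ (@tcons R n) (@measurable_tcons R n).

(* R^n is n.-tuple R with the product of the Borel sigma-algebras of R (which is
   the Borel sigma-algebra of R^n); gaussian R n is the n-fold product of the
   standard normal law, transported along R * R^n -> R^(n+1). *)
Fixpoint gaussian (R : realType) (n : nat) : probability (n.-tuple R) R :=
  match n with
  | 0 => \d_([tuple] : 0.-tuple R)
  | m.+1 => distribution (normal_prob (0 : R) 1 \x gaussian R m)%E (@tcons R m)
  end.

Definition dot (R : realType) (n : nat) (x y : n.-tuple R) : R :=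
  \sum_(i < n) tnth x i * tnth y i.

Definition lincomb (R : realType) (n : nat) (a : R) (x : n.-tuple R)
    (b : R) (y : n.-tuple R) : n.-tuple R :=
  [tuple a * tnth x i + b * tnth y i | i < n].

Definition ou_semigroup (R : realType) (n : nat) (t : R)
    (f : n.-tuple R -> R) (x : n.-tuple R) : R :=
  fine ('E_(gaussian R n)[fun z =>
    f (lincomb (expR (- t)) x (Num.sqrt (1 - expR (- (2 * t)))) z)])%E.

Definition noise_sensitive (R : realType) (n : nat -> nat)
    (A : forall i, set ((n i).-tuple R)) : Prop :=
  forall t : R, 0 < t ->
    ('V_(gaussian R (n i))[ou_semigroup t \1_(A i)])%E @[i --> \oo] --> 0%E.

(* Since stability is the mere negation of sensitivity, a sequence is stable as
   soon as one of its subsequences is; alternating a half-line with the empty set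
   gives a stable sequence. Hence stability only controls infinitely many indices;
   to control all large indices, every subsequence must be stable. *)
Definition noise_stable (R : realType) (n : nat -> nat)
    (A : forall i, set ((n i).-tuple R)) : Prop :=
  ~ noise_sensitive A.

(* The degenerate case a = 0 (the empty set or the whole space) is included. *)
Definition half_space (R : realType) (n : nat) (A : set (n.-tuple R)) : Prop :=
  exists (a : n.-tuple R) (b : R), A = [set x | dot x a <= b].

(* M(B), as an extended real; it lies in [0, 1/4] for measurable B. *)
Definition half_space_corr (R : realType) (n : nat) (B : set (n.-tuple R)) : \bar R :=
  ereal_sup [set covariance (gaussian R n) \1_A \1_B | A in @half_space R n].

(* B_{t,y}. *)
Definition restriction (R : realType) (n : nat) (B : set (n.-tuple R))
    (t : R) (y : n.-tuple R) : set (n.-tuple R) :=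
  [set x | B (lincomb (Num.sqrt (1 - expR (- (2 * t)))) x (expR (- t)) y)].

(* Gaussian probability at least e that M(B_{t,Y}) >= e. *)
Definition correlated_restrictions (R : realType) (n : nat)
    (B : set (n.-tuple R)) (t e : R) : Prop :=
  (e%:E <= gaussian R n
     [set y | (e%:E <= half_space_corr (restriction B t y))%E])%E.

(* Main.v *)
From HB Require Import structures.
Require Import Defs.
From mathcomp Require Import all_boot all_order all_algebra.
From mathcomp Require Import all_classical all_reals all_analysis.
From mathcomp Require Import measurable_realfun ring lra.

Set Implicit Arguments.
Unset Strict Implicit.
Unset Printing Implicit Defensive.

Import Order.TTheory GRing.Theory Num.Theory numFieldNormedType.Exports.

Local Open Scope classical_set_scope.
Local Open Scope ring_scope.

(** Let h = P_t 1_B, so that h(y) is the Gaussian measure of the restriction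
B_{t,y}.  With r = exp(-t) and s = sqrt(1 - r^2), the restriction is the
preimage of B under x |-> s x + r y.  The theorem compares two numbers, with
constants that depend neither on the dimension nor on B: the variance of h
for some time, and the probability that B_{t,Y} is correlated with a
half-space.

A large variance at time t gives correlation at the same t
([correlated_of_variance]).  Let w(y) be the barycenter of B_{t,y}, that is
the mean of X over the Gaussian measure restricted to B_{t,y}.  By the
Cameron-Martin formula ([gaussian_shift]) the gradient of h at y is
(r / s) w(y), and the Gaussian Poincare inequality bounds Var h by a constant
times E |w(Y)|^2 ([gaussian_poincare]).  It is proved by a discrete form of the
argument of Maurey and Pisier: h(Y') - h(Y) is a sum of N increments of h along
the rotation from Y to an independent copy Y'; rotation invariance of the
Gaussian measure gives them all the same L^2 norm, and for N large this norm is
governed by the gradient.  Errors that depend on the dimension disappear as N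
grows.  As |w| <= 1, a lower bound on E |w(Y)|^2 makes |w(Y)| large with
positive probability.  Finally |w|^2 is the covariance of 1_{B_{t,y}} with the
linear function <w, x>, and this function is close to an average of indicators
of half-spaces with normal direction w; hence the supremum of the covariances
is at least |w|^2 / 2 ([half_space_corr_ge_barycenter]).

Conversely, correlation gives variance at a smaller time u that depends only on
t and epsilon ([variance_of_correlated]).  Half-spaces are stable under small
noise, uniformly in the dimension ([half_space_stable]): the law of a linear
functional is a one-dimensional normal law ([gaussian_dot]), which has a bounded
density.  So if B_{t,y} is correlated with a half-space, then this remains true
of its indicator smoothed by a small noise, which therefore deviates from every
constant in L^2 ([smooth_deviation_of_cov]).  The smoothed indicator of B_{t,y}
is x |-> P_u 1_B (a x + b y) with a^2 + b^2 = 1, and averaging over y gives back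
Var (P_u 1_B).

The passage to sequences uses in addition that Var (P_t 1_B) is nonincreasing
in t ([ou_var_antitone]): if no pair (t, epsilon) works for all large i, a
diagonal choice of indices along t = 1 / j produces a noise sensitive
subsequence. *)

(** * Lebesgue measure: integration against a density and translations *)

Section density.
Local Open Scope ereal_scope.
Context d (T : measurableType d) (R : realType).
Variables (mu nu : {measure set T -> \bar R}) (p : T -> R).
Hypotheses (mp : measurable_fun setT p) (p0 : forall x, (0 <= p x)%R).
Hypothesis nuE : forall A, measurable A -> nu A = \int[mu]_(x in A) (p x)%:E.

Import HBNNSimple.

(** The hypothesis is the case of indicators; the general case follows from it
by simple functions and monotone convergence. *)
Lemma ge0_integral_density (f : T -> \bar R) :
  measurable_fun setT f -> (forall x, 0 <= f x) ->
  \int[nu]_x f x = \int[mu]_x (f x * (p x)%:E).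
Proof.
move=> mf f0; pose g := nnsfun_approx measurableT mf.
have gf x : EFin \o g ^~ x @ \oo --> f x by apply: cvg_nnsfun_approx.
have mgp n : measurable_fun setT (fun x => (g n x)%:E * (p x)%:E).
  apply: emeasurable_funM; apply/measurable_EFinP => //.
transitivity (limn (fun n => \int[nu]_x (g n x)%:E)).
  rewrite -monotone_convergence//.
  - by apply: eq_integral => x _; apply/esym/cvg_lim => //; exact: gf.
  - by move=> n; exact/measurable_EFinP.
  - by move=> n x _; rewrite lee_fin.
  - by move=> x _ a b ab; rewrite lee_fin; exact/lefP/nd_nnsfun_approx.
transitivity (limn (fun n => \int[mu]_x ((g n x)%:E * (p x)%:E))).
  congr (limn _); apply/funext => n.
  transitivity (\sum_(r \in range (g n)) \int[nu]_x (r * \1_(g n @^-1` [set r]) x)%:E).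
    under eq_integral do rewrite fimfunE -fsumEFin//.
    rewrite ge0_integral_fsum//.
    - by move=> y; exact/measurable_EFinP/measurable_funM.
    - by move=> y x _; rewrite nnfun_muleindic_ge0.
  transitivity (\sum_(r \in range (g n))
      \int[mu]_x ((r * \1_(g n @^-1` [set r]) x)%:E * (p x)%:E)); last first.
    rewrite -ge0_integral_fsum//; last 2 first.
    - by move=> y; apply: emeasurable_funM; apply/measurable_EFinP => //;
        exact/measurable_funM.
    - move=> y x _; apply: mule_ge0; last by rewrite lee_fin.
      by rewrite EFinM nnfun_muleindic_ge0.
    apply: eq_integral => x _; rewrite (fimfunE (g n) x) -fsumEFin//.
    rewrite -ge0_mule_fsuml// => r; exact: nnfun_muleindic_ge0.
  apply: eq_fsbigr => r /[!inE] -[y _ <-].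
  have mA : measurable (g n @^-1` [set g n y]) by [].
  under eq_integral do rewrite EFinM.
  rewrite ge0_integralZl//; last 2 first.
    exact/measurable_EFinP/measurable_indic.
    by rewrite lee_fin.
  rewrite integral_indic// setIT nuE//.
  under [RHS]eq_integral do rewrite EFinM -muleA.
  rewrite ge0_integralZl//; last 3 first.
    apply: emeasurable_funM; apply/measurable_EFinP => //.
    by move=> x _; rewrite mule_ge0// lee_fin.
    by rewrite lee_fin.
  congr (_ * _); rewrite integral_mkcond; apply: eq_integral => x _.
  by rewrite patchE indicE; case: ifPn => _; rewrite ?mul1e ?mul0e.
rewrite -(@monotone_convergence _ _ _ mu setT measurableT
  (fun n x => (g n x)%:E * (p x)%:E))//.
- apply: eq_integral => x _; apply/cvg_lim => //.
  apply: cvgeZr => //; exact: gf.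
- by move=> n x _; rewrite mule_ge0// lee_fin.
- move=> x _ a b ab; rewrite lee_pmul// ?lee_fin//.
  exact/lefP/nd_nnsfun_approx.
Qed.

End density.

Section lebesgue_translation.
Local Open Scope ereal_scope.
Context {R : realType}.
Local Notation mu := (@lebesgue_measure R).

Lemma lebesgue_measure_shift (a : R) (A : set (measurableTypeR R)) :
  measurable A ->
  pushforward mu (fun x => x + a : measurableTypeR R)%R A = mu A.
Proof.
move=> mA.
have ms : measurable_fun setT (fun x : measurableTypeR R => x + a : measurableTypeR R)%R.
  by apply: measurable_funD.
pose mi := isMeasurableFun.Build _ _ _ _ _ ms.
pose s : {mfun _ >-> _} := HB.pack (fun x : measurableTypeR R => x + a : measurableTypeR R)%R mi.
apply/esym/(@lebesgue_measure_unique _ (pushforward mu s)) => //= _ [[b c]] _ <-.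
rewrite /pushforward/=.
rewrite (_ : _ @^-1` _ = `](b - a), (c - a)]%classic)%R; last first.
  by apply/seteqP; split => x /=; rewrite !in_itv/= ltrBlDr lerBrDr.
rewrite !lebesgue_measure_itv/= !lte_fin ltrD2r; case: ifP => // _.
by congr EFin; ring.
Qed.

Lemma ge0_integral_lebesgue_shift (a : R) (f : R -> \bar R) :
  measurable_fun [set: R] f -> (forall r, 0 <= f r) ->
  \int[mu]_r f (r + a)%R = \int[mu]_r f r.
Proof.
move=> mf f0.
transitivity (\int[pushforward mu (fun x => x + a : measurableTypeR R)%R]_r f r).
  rewrite ge0_integral_pushforward//=; first by apply: measurable_funD.
apply: eq_measure_integral => /=; first by move=> mT A mA; exact: measurable_funD.
by move=> mT A mA _; exact: lebesgue_measure_shift.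
Qed.

End lebesgue_translation.

(** * The standard normal law *)

Section normal1.
Local Open Scope ereal_scope.
Context {R : realType}.
Local Notation mu := (@lebesgue_measure R).
Local Notation N := (normal_prob (0 : R) 1).
Local Notation phi := (normal_pdf (0 : R) 1).

Lemma normal_pdf01E x : phi x = (normal_peak 1 * expR (- x ^+ 2 / 2))%R.
Proof.
rewrite normal_pdfE ?oner_neq0//=.
by rewrite /normal_fun subr0 expr1n.
Qed.

Lemma ge0_integral_normal (f : R -> \bar R) :
  measurable_fun [set: R] f -> (forall r, 0 <= f r) ->
  \int[N]_r f r = \int[mu]_r (f r * (phi r)%:E).
Proof.
move=> mf f0; apply: ge0_integral_density => //.
- exact: measurable_normal_pdf.
- by move=> x; exact: normal_pdf_ge0.
Qed.

Lemma normal_pdf01_shift (a x : R) :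
  (phi (x - a) = expR (a * x - a ^+ 2 / 2) * phi x)%R.
Proof.
rewrite !normal_pdf01E mulrCA -expRD; congr (_ * expR _)%R; by field.
Qed.

Lemma measurable_EFin_normal_pdf :
  measurable_fun [set: R] (fun x => (phi x)%:E).
Proof. by apply/measurable_EFinP; exact: measurable_normal_pdf. Qed.

Lemma measurable_tilt1 (a : R) :
  measurable_fun [set: R] (fun r => (expR (a * r - a ^+ 2 / 2))%:E).
Proof.
apply/measurable_EFinP/measurableT_comp => //.
by apply: measurable_funB => //; apply: measurable_funM.
Qed.

(** The Cameron-Martin formula on the line. *)
Lemma normal_shift (a : R) (f : R -> \bar R) :
  measurable_fun [set: R] f -> (forall r, 0 <= f r) ->
  \int[N]_r f (r + a)%R = \int[N]_r (f r * (expR (a * r - a ^+ 2 / 2))%:E).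
Proof.
move=> mf f0; have mt := measurable_tilt1 a.
have mp := measurable_EFin_normal_pdf.
rewrite !ge0_integral_normal//; last 3 first.
- exact: emeasurable_funM.
- by move=> r; rewrite mule_ge0// lee_fin expR_ge0.
- by apply: measurableT_comp => //; exact: measurable_funD.
rewrite -[RHS](ge0_integral_lebesgue_shift a); last 2 first.
- by do 2 apply: emeasurable_funM => //.
- by move=> r; rewrite !mule_ge0// lee_fin ?expR_ge0// normal_pdf_ge0.
apply: eq_integral => x _; rewrite -muleA; congr (_ * _).
by rewrite -EFinM -normal_pdf01_shift addrK.
Qed.

Lemma ge0_lebesgue_shearl (l : R) (F : R * R -> \bar R) :
  measurable_fun [set: R * R] F -> (forall r, 0 <= F r) ->
  \int[mu]_x \int[mu]_y F (x + l * y, y)%R = \int[mu]_x \int[mu]_y F (x, y).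
Proof.
move=> mF F0.
have ms : measurable_fun [set: R * R] (fun p => F (p.1 + l * p.2, p.2)%R).
  apply: measurableT_comp => //; apply: measurable_fun_pair => //=.
  by apply: measurable_funD => //; apply: measurable_funM.
pose FT := @fubini_tonelli _ _ (measurableTypeR R) (measurableTypeR R) R mu mu.
apply: (etrans (FT _ ms (fun=> F0 _))); apply: (etrans _ (esym (FT _ mF F0))).
apply: eq_integral => y _ /=.
rewrite (ge0_integral_lebesgue_shift (l * y) (f := fun z : R => F (z, y : R)))//.
exact: measurableT_comp.
Qed.

Lemma ge0_lebesgue_shearr (l : R) (F : R * R -> \bar R) :
  measurable_fun [set: R * R] F -> (forall r, 0 <= F r) ->
  \int[mu]_x \int[mu]_y F (x, y + l * x)%R = \int[mu]_x \int[mu]_y F (x, y).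
Proof.
move=> mF F0; apply: eq_integral => x _ /=.
rewrite (ge0_integral_lebesgue_shift (l * x) (f := fun z : R => F (x : R, z)))//.
exact: measurableT_comp.
Qed.

(** A plane rotation of angle other than pi is a product of three shears, and
each shear preserves Lebesgue measure by Fubini and translation invariance. *)
Lemma ge0_lebesgue_rotation (c s : R) (F : R * R -> \bar R) :
  (c ^+ 2 + s ^+ 2 = 1)%R -> (c != -1)%R ->
  measurable_fun [set: R * R] F -> (forall r, 0 <= F r) ->
  \int[mu]_x \int[mu]_y F (c * x + s * y, - s * x + c * y)%R =
  \int[mu]_x \int[mu]_y F (x, y).
Proof.
move=> cs c1 mF F0.
have c10 : (1 + c != 0)%R by rewrite addrC addr_eq0.
(* l is the tangent of half the angle, and - s is the slope of the middle shear. *)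
pose l : R := (s / (1 + c))%R.
have lE : (1 - s * l = c)%R.
  rewrite /l mulrA -expr2.
  have -> : (s ^+ 2 = 1 - c ^+ 2)%R by rewrite -cs; ring.
  by field.
have lcE : (l * (1 + c) = s)%R by rewrite /l divfK.
pose F1 (p : R * R) := F (p.1 + l * p.2, p.2)%R.
pose F2 (p : R * R) := F1 (p.1, p.2 + (- s) * p.1)%R.
have mF1 : measurable_fun [set: R * R] F1.
  apply: measurableT_comp => //; apply: measurable_fun_pair => //=.
  by apply: measurable_funD => //; apply: measurable_funM.
have mF2 : measurable_fun [set: R * R] F2.
  apply: measurableT_comp => //; apply: measurable_fun_pair => //=.
  by apply: measurable_funD => //; apply: measurable_funM.
apply: (etrans _ (ge0_lebesgue_shearl l mF F0)).
apply: (etrans _ (ge0_lebesgue_shearr (- s) mF1 (fun=> F0 _))).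
apply: (etrans _ (ge0_lebesgue_shearl l mF2 (fun=> F0 _))).
apply: eq_integral => x _; apply: eq_integral => y _; rewrite /F2 /F1/=.
congr (F (_, _)).
- by rewrite -[in LHS]lcE -[in LHS]lE; ring.
- by rewrite -[in LHS]lE; ring.
Qed.

Lemma ge0_integral_normal2 (F : R * R -> \bar R) :
  measurable_fun [set: R * R] F -> (forall r, 0 <= F r) ->
  \int[N]_x \int[N]_y F (x, y) =
  \int[mu]_x \int[mu]_y (F (x, y) * (phi x * phi y)%:E).
Proof.
move=> mF F0; have mp := measurable_EFin_normal_pdf.
have p0 z : (0 <= phi z)%R by exact: normal_pdf_ge0.
rewrite ge0_integral_normal; last 2 first.
- exact: (@measurable_fun_fubini_tonelli_F _ _ (measurableTypeR R) (measurableTypeR R)).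
- by move=> x; apply: integral_ge0.
apply: eq_integral => x _; rewrite ge0_integral_normal//; last first.
  exact: measurableT_comp.
have mFx : measurable_fun [set: R] (fun y => F (x : R, y) * (phi y)%:E).
  by apply: emeasurable_funM => //; exact: measurableT_comp.
rewrite -ge0_integralZr//; last 2 first.
- by move=> y _; rewrite mule_ge0// lee_fin.
- by rewrite lee_fin.
by apply: eq_integral => y _; rewrite -muleA -EFinM mulrC.
Qed.

(** The density of the product law depends only on x^2 + y^2, so the invariance
of Lebesgue measure passes to it. *)
Lemma normal_rotation (c s : R) (F : R * R -> \bar R) :
  (c ^+ 2 + s ^+ 2 = 1)%R -> (c != -1)%R ->
  measurable_fun [set: R * R] F -> (forall r, 0 <= F r) ->
  \int[N]_x \int[N]_y F (c * x + s * y, - s * x + c * y)%R =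
  \int[N]_x \int[N]_y F (x, y).
Proof.
move=> cs c1 mF F0; have mp := measurable_EFin_normal_pdf.
have p0 z : (0 <= phi z)%R by exact: normal_pdf_ge0.
pose G (p : R * R) := F p * (phi p.1 * phi p.2)%:E.
have mG : measurable_fun [set: R * R] G.
  apply: emeasurable_funM => //; apply/measurable_EFinP/measurable_funM.
  - by apply: (measurableT_comp (measurable_normal_pdf 0 1)) => //.
  - by apply: (measurableT_comp (measurable_normal_pdf 0 1)) => //.
have mR : measurable_fun [set: R * R]
    (fun p => F (c * p.1 + s * p.2, - s * p.1 + c * p.2)%R).
  apply: measurableT_comp => //; apply: measurable_fun_pair => //=;
  by apply: measurable_funD; apply: measurable_funM.
apply: (etrans (ge0_integral_normal2 mR (fun=> F0 _))).
apply: (etrans _ (esym (ge0_integral_normal2 mF F0))).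
have G0 r : 0 <= G r by rewrite mule_ge0// lee_fin mulr_ge0.
apply: (etrans _ (ge0_lebesgue_rotation cs c1 mG G0)).
apply: eq_integral => x _; apply: eq_integral => y _; rewrite /G/=.
congr (_ * _%:E); rewrite !normal_pdf01E mulrACA [in RHS]mulrACA -!expRD.
congr (_ * expR _)%R; rewrite -!mulrDl -!opprD; congr (- _ / _)%R.
by rewrite -[LHS]mul1r -cs; ring.
Qed.

Lemma integral_normal_cst (r : \bar R) : \int[N]_x r = r.
Proof. by rewrite integral_cst//= [X in _ * X]probability_setT mule1. Qed.

(** Rotation by a right angle carries the second coordinate to the opposite of
the first. *)
Lemma normal_opp (F : R -> \bar R) :
  measurable_fun [set: R] F -> (forall r, 0 <= F r) ->
  \int[N]_x F (- x)%R = \int[N]_x F x.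
Proof.
move=> mF F0.
have c0 : (0 ^+ 2 + 1 ^+ 2 = 1 :> R)%R by ring.
have c1 : (0 != -1 :> R)%R by rewrite eq_sym oppr_eq0 oner_eq0.
have := @normal_rotation 0 1 (fun p => F p.2) c0 c1.
have mF2 : measurable_fun [set: R * R] (fun p => F p.2) by exact: measurableT_comp.
move=> /(_ mF2 (fun r => F0 _)) /=.
under eq_integral => x _ do under eq_integral => y _ do rewrite mulN1r mul0r addr0.
under eq_integral => x _ do rewrite integral_normal_cst.
by move=> ->; rewrite integral_normal_cst.
Qed.

(** The normal density is at most 1; this is the anti-concentration that makes
half-spaces noise stable. *)
Lemma normal_itv_le (a b : R) : (a <= b)%R -> N `[a, b]%classic <= (b - a)%:E.
Proof.
move=> ab; rewrite /normal_prob.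
apply: (@le_trans _ _ (\int[mu]_(x in `[a, b]%classic) (cst 1%:E x))).
  apply: ge0_le_integral => //.
  - by move=> x _; rewrite lee_fin normal_pdf_ge0.
  - by apply: measurable_funTS; exact: measurable_EFin_normal_pdf.
  - move=> x _; rewrite lee_fin normal_pdf01E mulr_ile1 ?expR_ge0 ?normal_peak_ge0//.
    + have p1 : (1 <= pi *+ 2 :> R)%R by have := @pi_ge2 R; rewrite -mulr_natr; lra.
      have sp1 : (1 <= Num.sqrt (pi *+ 2) :> R)%R.
        by rewrite -[leLHS]sqrtr1 ler_wsqrtr.
      by rewrite /normal_peak expr1n mul1r invf_le1// (lt_le_trans _ sp1).
    + by rewrite -[leRHS]expR0 ler_expR mulNr oppr_le0 mulr_ge0// sqr_ge0.
rewrite integral_cst//= mul1e lebesgue_measure_itv/= lte_fin.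
by case: ifP => // _; rewrite lee_fin subr_ge0.
Qed.

End normal1.

(** * The Gaussian measure on R^n *)

Section vectors.
Context {R : realType}.
Implicit Types n : nat.

Lemma tnth_lincomb n a (x : n.-tuple R) b y i :
  tnth (lincomb a x b y) i = a * tnth x i + b * tnth y i.
Proof. by rewrite tnth_mktuple. Qed.

Lemma lincomb_tcons n a (p : R * n.-tuple R) b q :
  lincomb a (tcons p) b (tcons q) =
  tcons (a * p.1 + b * q.1, lincomb a p.2 b q.2).
Proof.
apply: eq_from_tnth => i; rewrite tnth_lincomb /tcons.
have [->|[j ->]] : i = ord0 \/ exists j, i = lift ord0 j.
  by case: (unliftP ord0 i) => [j ->|->]; [right; exists j|left].
  by rewrite !tnth0.
by rewrite !tnthS tnth_lincomb.
Qed.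

Lemma dot_tcons n (p q : R * n.-tuple R) :
  dot (tcons p) (tcons q) = p.1 * q.1 + dot p.2 q.2.
Proof.
by rewrite /dot big_ord_recl !tnth0; congr (_ + _); apply: eq_bigr => i _; rewrite !tnthS.
Qed.

Lemma tcons_eta n (x : n.+1.-tuple R) : exists p, x = tcons p.
Proof. by exists (thead x, [tuple of behead x]); rewrite {1}(tuple_eta x). Qed.

Lemma dot_lincomb n (u : n.-tuple R) a x b y :
  dot u (lincomb a x b y) = a * dot u x + b * dot u y.
Proof.
rewrite /dot !mulr_sumr -big_split/=; apply: eq_bigr => i _.
by rewrite tnth_lincomb; ring.
Qed.

Lemma dotC n (x y : n.-tuple R) : dot x y = dot y x.
Proof. by apply: eq_bigr => i _; rewrite mulrC. Qed.

Lemma dot_ge0 n (x : n.-tuple R) : 0 <= dot x x.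
Proof. by apply: sumr_ge0 => i _; rewrite -expr2 sqr_ge0. Qed.

Lemma measurable_fun_lincomb d (T : measurableType d) n a b (f g : T -> n.-tuple R) :
  measurable_fun setT f -> measurable_fun setT g ->
  measurable_fun setT (fun x => lincomb a (f x) b (g x)).
Proof.
move=> mf mg; apply/measurable_fun_tnthP => i.
rewrite (_ : _ \o _ = fun x => a * tnth (f x) i + b * tnth (g x) i); last first.
  by apply/funext => x /=; rewrite tnth_lincomb.
apply: measurable_funD; apply: measurable_funM => //.
- exact: (measurableT_comp (measurable_tnth i) mf).
- exact: (measurableT_comp (measurable_tnth i) mg).
Qed.

Lemma measurable_fun_dot d (T : measurableType d) n (f g : T -> n.-tuple R) :
  measurable_fun setT f -> measurable_fun setT g ->
  measurable_fun setT (fun x => dot (f x) (g x)).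
Proof.
move=> mf mg; apply: measurable_sum => i; apply: measurable_funM.
- exact: (measurableT_comp (measurable_tnth i) mf).
- exact: (measurableT_comp (measurable_tnth i) mg).
Qed.

Lemma measurable_fun_tcons d (T : measurableType d) n (f : T -> R) (g : T -> n.-tuple R) :
  measurable_fun setT f -> measurable_fun setT g ->
  measurable_fun setT (fun x => tcons (f x, g x)).
Proof. by move=> mf mg; exact: measurable_cons. Qed.

End vectors.

Section gauss.
Local Open Scope ereal_scope.
Context {R : realType}.
Local Notation N := (normal_prob (0 : R) 1).
Local Notation G n := (gaussian R n).

Lemma ge0_integral_gaussianS n (F : n.+1.-tuple R -> \bar R) :
  measurable_fun [set: n.+1.-tuple R] F -> (forall x, 0 <= F x) ->
  \int[G n.+1]_x F x = \int[N]_a \int[G n]_x F (tcons (a, x)).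
Proof.
move=> mF F0; rewrite /= ge0_integral_distribution//.
rewrite -(fubini_tonelli1 (F \o @tcons R n))//; last by move=> ?; exact: F0.
by apply: measurableT_comp => //; exact: measurable_tcons.
Qed.

Lemma integral_gaussian_cst n (r : \bar R) : \int[G n]_x r = r.
Proof. by rewrite integral_cst//= [X in _ * X]probability_setT mule1. Qed.

(** The density of the law of X + v with respect to the law of X. *)
Definition tilt n (v x : n.-tuple R) : R := expR (dot v x - dot v v / 2).

Lemma measurable_fun_tilt n (v : n.-tuple R) : measurable_fun setT (tilt v).
Proof.
apply: measurableT_comp => //; apply: measurable_funB => //.
exact: measurable_fun_dot.
Qed.

(** The Cameron-Martin formula in dimension n, one coordinate at a time. *)
Lemma gaussian_shift n (v : n.-tuple R) (F : n.-tuple R -> \bar R) :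
  measurable_fun [set: n.-tuple R] F -> (forall x, 0 <= F x) ->
  \int[G n]_x F (lincomb 1 x 1 v) = \int[G n]_x (F x * (tilt v x)%:E).
Proof.
elim: n v F => [|n IH] v F mF F0.
  apply: eq_integral => x _; rewrite /tilt /dot !big_ord0 mul0r subr0 expR0 mule1.
  by congr F; rewrite (tuple0 x); apply: eq_from_tnth => -[].
have [[a w] ->] := tcons_eta v.
have mt k (u : k.-tuple R) : measurable_fun setT (fun x => (tilt u x)%:E).
  by apply/measurable_EFinP; exact: measurable_fun_tilt.
have t0 k (u x : k.-tuple R) : 0 <= (tilt u x)%:E by rewrite lee_fin expR_ge0.
rewrite ge0_integral_gaussianS//; last first.
  by apply: measurableT_comp => //; exact: measurable_fun_lincomb.
rewrite ge0_integral_gaussianS//; last 2 first.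
- by apply: emeasurable_funM => //; exact: mt.
- by move=> x; rewrite mule_ge0.
have mFt : measurable_fun [set: R * n.-tuple R] (fun p => F (tcons p)).
  by apply: measurableT_comp => //; exact: measurable_tcons.
have mFt1 b : measurable_fun [set: n.-tuple R] (fun x => F (tcons (b, x))).
  exact: (measurableT_comp mFt).
pose H b := \int[G n]_x (F (tcons (b, x)) * (tilt w x)%:E).
transitivity (\int[N]_b H (b + a)%R).
  apply: eq_integral => b _.
  under eq_integral do rewrite lincomb_tcons/= !mul1r.
  by rewrite (IH w (fun x => F (tcons ((b + a)%R, x)))).
have mFw : measurable_fun [set: R * n.-tuple R]
    (fun p => F (tcons p) * (tilt w p.2)%:E).
  by apply: emeasurable_funM => //; exact: (measurableT_comp (mt _ w)).
rewrite normal_shift//; last 2 first.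
- exact: (@measurable_fun_fubini_tonelli_F _ _ (measurableTypeR R) _ _ (G n) _ mFw
    (fun p => mule_ge0 (F0 _) (t0 _ _ _))).
- by move=> b; apply: integral_ge0 => x _; rewrite mule_ge0.
apply: eq_integral => b _; rewrite /H -ge0_integralZr//; last 2 first.
- by apply: emeasurable_funM => //; exact: mt.
- by move=> x _; rewrite mule_ge0.
apply: eq_integral => x _; rewrite -muleA -EFinM; congr (_ * _%:E).
by rewrite /tilt -expRD !dot_tcons/=; congr expR; field.
Qed.

(** The same plane rotation is applied to each pair (x_i, y_i), so the case of
one coordinate and Fubini suffice. *)
Lemma gaussian_rotation n (c s : R) (F : n.-tuple R * n.-tuple R -> \bar R) :
  (c ^+ 2 + s ^+ 2 = 1)%R -> (c != -1)%R ->
  measurable_fun setT F -> (forall r, 0 <= F r) ->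
  \int[G n]_x \int[G n]_y F (lincomb c x s y, lincomb (- s) x c y) =
  \int[G n]_x \int[G n]_y F (x, y).
Proof.
move=> cs c1; elim: n F => [|n IH] F mF F0.
  apply: eq_integral => x _; apply: eq_integral => y _.
  by congr (F (_, _)); rewrite (tuple0 x) ?(tuple0 y); apply: eq_from_tnth => -[].
(* Regrouping the coordinates of (R * R^n) * (R * R^n) as (R * R) * (R^n * R^n)
   separates the rotation of the first coordinates from that of the rest. *)
have swap (K : n.+1.-tuple R * n.+1.-tuple R -> \bar R) :
    measurable_fun setT K -> (forall r, 0 <= K r) ->
    \int[G n.+1]_x \int[G n.+1]_y K (x, y) =
    \int[N]_a \int[N]_b \int[G n]_x \int[G n]_y K (tcons (a, x), tcons (b, y)).
  move=> mK K0.
  have mKp (T : measurableType _) (f : T -> n.+1.-tuple R) (g : T -> n.+1.-tuple R) :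
      measurable_fun setT f -> measurable_fun setT g ->
      measurable_fun setT (fun x => K (f x, g x)).
    by move=> mf mg; apply: measurableT_comp => //; exact: measurable_fun_pair.
  rewrite ge0_integral_gaussianS; last 2 first.
  - exact: (measurable_fun_fubini_tonelli_F _ mK).
  - by move=> x; exact: integral_ge0.
  apply: eq_integral => a _.
  under eq_integral => x _.
    rewrite ge0_integral_gaussianS//; last exact: mKp.
    over.
  rewrite (@fubini_tonelli _ _ _ _ _ (G n) N
    (fun p => \int[G n]_y K (tcons (a, p.1), tcons (p.2, y))))//.
  - apply: (measurable_fun_fubini_tonelli_F
     (fun q : (n.-tuple R * R) * n.-tuple R => K (tcons (a, q.1.1), tcons (q.1.2, q.2)))) => //.
    apply: mKp; apply: measurable_fun_tcons => //.
    + exact: measurableT_comp.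
    + exact: measurableT_comp.
  - by move=> p; exact: integral_ge0.
have mR : measurable_fun setT
    (fun p : n.+1.-tuple R * n.+1.-tuple R =>
       F (lincomb c p.1 s p.2, lincomb (- s) p.1 c p.2)).
  apply: measurableT_comp => //.
  by apply: measurable_fun_pair; exact: measurable_fun_lincomb.
apply: (etrans (swap _ mR (fun=> F0 _))).
apply: (etrans _ (esym (swap F mF F0))).
pose H (p : R * R) := \int[G n]_x \int[G n]_y F (tcons (p.1, x), tcons (p.2, y)).
transitivity (\int[N]_a \int[N]_b H (c * a + s * b, - s * a + c * b)%R).
  apply: eq_integral => a _; apply: eq_integral => b _.
  under eq_integral do under eq_integral do rewrite !lincomb_tcons/=.
  have mFab : measurable_fun setT (fun p : n.-tuple R * n.-tuple R =>
      F (tcons ((c * a + s * b)%R, p.1), tcons ((- s * a + c * b)%R, p.2))).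
    apply: measurableT_comp => //.
    by apply: measurable_fun_pair; apply: measurable_fun_tcons.
  exact: (IH _ mFab (fun=> F0 _)).
have mH : measurable_fun setT H.
  apply: (measurable_fun_fubini_tonelli_F
    (fun q : (R * R) * n.-tuple R => \int[G n]_y F (tcons (q.1.1, q.2), tcons (q.1.2, y)))).
  - apply: (measurable_fun_fubini_tonelli_F
      (fun q : ((R * R) * n.-tuple R) * n.-tuple R => F (tcons (q.1.1.1, q.1.2), tcons (q.1.1.2, q.2)))) => //.
    apply: measurableT_comp => //.
    by apply: measurable_fun_pair; apply: measurable_fun_tcons => //;
      do ?[apply: measurableT_comp => //].
  - by move=> p; exact: integral_ge0.
apply: (normal_rotation cs c1 mH) => p.
by apply: integral_ge0 => x _; exact: integral_ge0.
Qed.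

Lemma gaussian_lincomb n (c s : R) (F : n.-tuple R -> \bar R) :
  (c ^+ 2 + s ^+ 2 = 1)%R -> (c != -1)%R ->
  measurable_fun setT F -> (forall r, 0 <= F r) ->
  \int[G n]_x \int[G n]_y F (lincomb c x s y) = \int[G n]_x F x.
Proof.
move=> cs c1 mF F0.
have mF1 : measurable_fun setT (fun p : n.-tuple R * n.-tuple R => F p.1).
  exact: measurableT_comp.
apply: (etrans (gaussian_rotation cs c1 mF1 (fun=> F0 _))).
by apply: eq_integral => x _ /=; rewrite integral_gaussian_cst.
Qed.

(** The linear functional <a, x> has the law of |a| z: rotating the plane merges
the first coordinate with the normal variable that represents the others. *)
Lemma gaussian_dot n (a : n.-tuple R) (F : R -> \bar R) :
  measurable_fun setT F -> (forall r, 0 <= F r) ->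
  \int[G n]_x F (dot a x) = \int[N]_z F (Num.sqrt (dot a a) * z)%R.
Proof.
elim: n a F => [|n IH] a F mF F0.
  rewrite /dot big_ord0 sqrtr0.
  under eq_integral do rewrite big_ord0.
  under [RHS]eq_integral do rewrite mul0r.
  by rewrite integral_gaussian_cst integral_normal_cst.
have [[b w] ->] := tcons_eta a; set r := Num.sqrt _; pose s := Num.sqrt (dot w w).
have s0 : (0 <= s)%R by rewrite sqrtr_ge0.
have r2 : (r ^+ 2 = b ^+ 2 + s ^+ 2)%R.
  by rewrite !sqr_sqrtr ?dot_ge0// dot_tcons/= -expr2.
have mFm u v : measurable_fun setT (fun p : R * R => F (u * p.1 + v * p.2)%R).
  apply: measurableT_comp => //.
  by apply: measurable_funD; apply: measurable_funM.
rewrite ge0_integral_gaussianS//; last first.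
  by apply: measurableT_comp => //; exact: measurable_fun_dot.
transitivity (\int[N]_x \int[N]_z F (b * x + s * z)%R).
  apply: eq_integral => x _; under eq_integral do rewrite dot_tcons/=.
  rewrite (IH w (fun z => F (b * x + z)%R))//.
  by apply: measurableT_comp => //; exact: measurable_funD.
have [r0|r0] := eqVneq r 0%R.
  have b0 : b = 0%R by apply/eqP; rewrite -sqrf_eq0; have := sqr_ge0 s; have := sqr_ge0 b; move: r2; rewrite r0 expr0n/=; lra.
  have ss0 : s = 0%R by apply/eqP; rewrite -sqrf_eq0; have := sqr_ge0 s; have := sqr_ge0 b; move: r2; rewrite r0 expr0n/=; lra.
  rewrite r0 b0 ss0.
  under eq_integral do under eq_integral do rewrite !mul0r addr0.
  by under [RHS]eq_integral do rewrite mul0r; rewrite !integral_normal_cst.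
have rp : (0 < r)%R by rewrite lt_def r0 sqrtr_ge0.
have cs : ((b / r) ^+ 2 + (s / r) ^+ 2 = 1)%R.
  by rewrite !expr_div_n -mulrDl -r2 divff// expf_neq0.
(* For the angle pi, which the rotation lemma excludes, symmetry suffices. *)
have [c1|c1] := eqVneq (b / r)%R (-1)%R.
  have be : b = (- r)%R by rewrite -[b](divfK r0) c1 mulN1r.
  have ss0 : s = 0%R by apply/eqP; rewrite -sqrf_eq0; move: r2; rewrite be sqrrN; lra.
  rewrite be ss0.
  under eq_integral => x _.
    under eq_integral do rewrite mul0r addr0 mulNr -mulrN.
    rewrite integral_normal_cst; over.
  have mFr : measurable_fun setT (fun x : R => F (r * x)%R).
    by apply: measurableT_comp => //; exact: measurable_funM.
  exact: (normal_opp mFr (fun=> F0 _)).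
transitivity (\int[N]_x \int[N]_z F (r * ((b / r) * x + (s / r) * z))%R).
  apply: eq_integral => x _; apply: eq_integral => z _; congr F.
  by field.
have mFr : measurable_fun setT (fun p : R * R => F (r * p.1)%R).
  by apply: measurableT_comp => //; exact: measurable_funM.
apply: (etrans (normal_rotation cs c1 mFr (fun=> F0 _))).
by apply: eq_integral => x _ /=; rewrite integral_normal_cst.
Qed.

End gauss.

(** * Functions with finite moments and their means *)

Section finite_moments.
Context d (T : measurableType d) (R : realType) (P : probability T R).
Implicit Types f g : T -> R.

(** Finiteness of all moments, unlike integrability, is stable under products;
it settles every integrability condition below by closure properties. *)
Definition has_moments f := measurable_fun setT f /\
  forall k, (\int[P]_x (`|f x| ^+ k)%:E < +oo)%E.

Lemma moments_measurable f : has_moments f -> measurable_fun setT f. Proof. by case. Qed.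

Lemma measurable_normX f k :
  measurable_fun setT f -> measurable_fun setT (fun x => (`|f x| ^+ k)%:E).
Proof.
move=> mf; apply/measurable_EFinP; apply: measurable_funX.
exact: measurableT_comp.
Qed.

Lemma moments_dominated f (h : nat -> T -> R) :
  measurable_fun setT f -> (forall k, measurable_fun setT (h k)) ->
  (forall k x, `|f x| ^+ k <= h k x) ->
  (forall k, (\int[P]_x (h k x)%:E < +oo)%E) -> has_moments f.
Proof.
move=> mf mh fh hoo; split => // k; apply: le_lt_trans (hoo k).
apply: ge0_le_integral => //.
- exact: measurable_normX.
- exact/measurable_EFinP.
- by move=> x _; rewrite lee_fin.
Qed.

Lemma moments_le f g : measurable_fun setT f -> has_moments g ->
  (forall x, `|f x| <= `|g x|) -> has_moments f.
Proof.
move=> mf [mg goo] fg; apply: (@moments_dominated f (fun k x => `|g x| ^+ k)) => //.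
- by move=> k; apply: measurable_funX; exact: measurableT_comp.
- by move=> k x; rewrite lerXn2r ?nnegrE.
Qed.

Lemma integral_prob_cst (r : \bar R) : (\int[P]_x r = r)%E.
Proof. by rewrite integral_cst//= [X in (_ * X)%E]probability_setT mule1. Qed.

Lemma moments_bounded f C : measurable_fun setT f -> (forall x, `|f x| <= C) -> has_moments f.
Proof.
move=> mf fC; apply: (@moments_dominated f (fun k x => C ^+ k)) => //.
- by move=> k x; rewrite lerXn2r ?nnegrE// (le_trans _ (fC x)).
- by move=> k; rewrite integral_prob_cst ltry.
Qed.

Lemma moments_cst c : has_moments (fun=> c).
Proof. by apply: (@moments_bounded _ `|c|). Qed.

Lemma momentsD f g : has_moments f -> has_moments g -> has_moments (fun x => f x + g x).
Proof.
move=> [mf foo] [mg goo].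
apply: (@moments_dominated _ (fun k x => 2 ^+ k * `|f x| ^+ k + 2 ^+ k * `|g x| ^+ k)).
- exact: measurable_funD.
- by move=> k; apply: measurable_funD; apply: measurable_funM => //;
    apply: measurable_funX; exact: measurableT_comp.
- move=> k x; apply: (@le_trans _ _ ((2 * Num.max `|f x| `|g x|) ^+ k)).
    set m := Num.max _ _.
    have fm : `|f x| <= m by rewrite le_max lexx.
    have gm : `|g x| <= m by rewrite le_max lexx orbT.
    have h : `|f x + g x| <= 2 * m by rewrite (le_trans (ler_normD _ _))//; lra.
    by rewrite lerXn2r// nnegrE (le_trans _ h).
  rewrite exprMn -mulrDr ler_wpM2l ?exprn_ge0//.
  by rewrite maxEle; case: ifP => _; rewrite ?lerDr ?lerDl exprn_ge0.
- move=> k; under eq_integral do rewrite EFinD !EFinM.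
  rewrite ge0_integralD//;
    do ?[by apply: emeasurable_funM => //; exact: measurable_normX];
    do ?[by move=> x _; rewrite mule_ge0// lee_fin exprn_ge0].
  rewrite !ge0_integralZl//; do ?[exact: measurable_normX];
   do ?[by move=> x _; rewrite lee_fin exprn_ge0]; do ?[by rewrite lee_fin exprn_ge0].
  by apply: lte_add_pinfty; apply: lte_mul_pinfty => //; rewrite ?lee_fin ?exprn_ge0.
Qed.

Lemma momentsM f g : has_moments f -> has_moments g -> has_moments (fun x => f x * g x).
Proof.
move=> [mf foo] [mg goo].
apply: (@moments_dominated _ (fun k x => `|f x| ^+ (2 * k) + `|g x| ^+ (2 * k))).
- exact: measurable_funM.
- by move=> k; apply: measurable_funD;
    apply: measurable_funX; exact: measurableT_comp.
- move=> k x; rewrite normrM exprMn mulnC !exprM.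
  set a := _ ^+ k; set b := _ ^+ k.
  have a0 : 0 <= a by rewrite exprn_ge0.
  have b0 : 0 <= b by rewrite exprn_ge0.
  have := sqr_ge0 (a - b); rewrite sqrrB; nra.
- move=> k; under eq_integral do rewrite EFinD.
  rewrite ge0_integralD//; do ?[exact: measurable_normX];
   do ?[by move=> x _; rewrite lee_fin exprn_ge0].
  by apply: lte_add_pinfty.
Qed.

Lemma momentsZ c f : has_moments f -> has_moments (fun x => c * f x).
Proof. by move=> nf; apply: momentsM => //; exact: moments_cst. Qed.

Lemma momentsN f : has_moments f -> has_moments (fun x => - f x).
Proof.
by move=> nf; apply: (moments_le _ nf) => [|x]; rewrite ?normrN//;
  apply: measurableT_comp => //; exact: moments_measurable.
Qed.

Lemma momentsB f g : has_moments f -> has_moments g -> has_moments (fun x => f x - g x).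
Proof. by move=> nf ng; apply: momentsD => //; exact: momentsN. Qed.

Lemma momentsX f k : has_moments f -> has_moments (fun x => f x ^+ k).
Proof.
move=> nf; elim: k => [|k IH]; first exact: moments_cst.
by under eq_fun do rewrite exprS; exact: momentsM.
Qed.

Lemma moments_sum (I : Type) (s : seq I) (F : I -> T -> R) :
  (forall i, has_moments (F i)) -> has_moments (fun x => \sum_(i <- s) F i x).
Proof.
move=> nF; elim: s => [|i s IH].
  by under eq_fun do rewrite big_nil; exact: moments_cst.
by under eq_fun do rewrite big_cons; exact: momentsD.
Qed.

Lemma moments_integrable f : has_moments f -> P.-integrable setT (EFin \o f).
Proof.
move=> [mf foo]; apply/integrableP; split; first exact/measurable_EFinP.
by under eq_integral do rewrite /= -[`|f _|%R]expr1; exact: foo.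
Qed.

Lemma moments_indic (A : set T) : measurable A -> has_moments (\1_A).
Proof.
move=> mA; apply: (@moments_bounded _ 1); first exact: measurable_indic.
by move=> x; rewrite indicE; case: (_ \in _); rewrite ?normr1 ?normr0.
Qed.

(** The real-valued expectation of a function that need not be bundled as a
random variable. *)
Definition mean f : R := \int[P]_x f x.

Lemma EFin_mean f : has_moments f -> ((mean f)%:E = \int[P]_x (f x)%:E)%E.
Proof.
by move=> nf; rewrite fineK//; apply: integrable_fin_num => //; exact: moments_integrable.
Qed.

Lemma meanD f g : has_moments f -> has_moments g -> mean (fun x => f x + g x) = mean f + mean g.
Proof. by move=> nf ng; rewrite /mean RintegralD//; exact: moments_integrable. Qed.

Lemma meanB f g : has_moments f -> has_moments g -> mean (fun x => f x - g x) = mean f - mean g.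
Proof. by move=> nf ng; rewrite /mean RintegralB//; exact: moments_integrable. Qed.

Lemma meanZ c f : has_moments f -> mean (fun x => c * f x) = c * mean f.
Proof. by move=> nf; rewrite /mean RintegralZl//; exact: moments_integrable. Qed.

Lemma meanZr c f : has_moments f -> mean (fun x => f x * c) = mean f * c.
Proof. by move=> nf; rewrite mulrC -meanZ//; congr mean; apply/funext => x; rewrite mulrC. Qed.

Lemma mean_cst c : mean (fun=> c) = c.
Proof. by rewrite /mean /Rintegral integral_prob_cst. Qed.

Lemma mean_ge0 f : (forall x, 0 <= f x) -> 0 <= mean f.
Proof. by move=> f0; apply: Rintegral_ge0. Qed.

Lemma mean_le f g : has_moments f -> has_moments g -> (forall x, f x <= g x) -> mean f <= mean g.
Proof. by move=> nf ng fg; apply: le_Rintegral => //; exact: moments_integrable. Qed.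

Lemma mean_sum (I : Type) (s : seq I) (F : I -> T -> R) :
  (forall i, has_moments (F i)) ->
  mean (fun x => \sum_(i <- s) F i x) = \sum_(i <- s) mean (F i).
Proof.
move=> nF; elim: s => [|i s IH].
  by rewrite big_nil; under eq_fun do rewrite big_nil; rewrite mean_cst.
under eq_fun do rewrite big_cons; rewrite meanD ?big_cons ?IH//.
exact: moments_sum.
Qed.

Lemma mean_indic A : measurable A -> (mean (\1_A))%:E = P A.
Proof. by move=> mA; rewrite EFin_mean ?integral_indic ?setIT//; exact: moments_indic. Qed.

Lemma mean_sqr_le f : has_moments f -> mean f ^+ 2 <= mean (fun x => f x ^+ 2).
Proof.
move=> nf; have := @mean_ge0 (fun x => (f x - mean f) ^+ 2) (fun x => sqr_ge0 _).
rewrite (_ : (fun x => _) = (fun x => f x ^+ 2 - 2 * mean f * f x + mean f ^+ 2)); last first.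
  by apply/funext => x; ring.
have n2 := momentsX 2 nf; have nZ := momentsZ (2 * mean f) nf.
rewrite (meanD (momentsB n2 nZ) (moments_cst (mean f ^+ 2))) (meanB n2 nZ) (meanZ _ nf) mean_cst; nra.
Qed.

Lemma expectation_mean f : has_moments f -> ('E_P[f] = (mean f)%:E)%E.
Proof. by move=> nf; rewrite unlock EFin_mean. Qed.

Lemma covariance_mean f g : has_moments f -> has_moments g ->
  covariance P f g = (mean (fun x => f x * g x) - mean f * mean g)%:E.
Proof.
move=> nf ng; have L h : has_moments h -> h \in Lfun P 1 by move=> ?; apply/Lfun1_integrable; exact: moments_integrable.
have nfg := momentsM nf ng.
rewrite covarianceE ?L//; rewrite !expectation_mean//.
Qed.

Lemma variance_mean f : has_moments f ->
  ('V_P[f] = (mean (fun x => (f x - mean f) ^+ 2))%:E)%E.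
Proof.
move=> nf; rewrite /variance covariance_mean//; congr EFin.
rewrite (_ : (fun x => (f x - _) ^+ 2) = (fun x => f x * f x - 2 * mean f * f x + mean f ^+ 2)); last first.
  by apply/funext => x; ring.
have n2 := momentsM nf nf; have nZ := momentsZ (2 * mean f) nf.
rewrite (meanD (momentsB n2 nZ) (moments_cst (mean f ^+ 2))) (meanB n2 nZ) (meanZ _ nf) mean_cst; ring.
Qed.

Lemma markov_bound f A c : has_moments f -> measurable A -> (forall x, 0 <= f x) -> 0 <= c ->
  (forall x, A x -> c <= f x) -> c * fine (P A) <= mean f.
Proof.
move=> nf mA f0 c0 cf; rewrite -mean_indic//= -meanZ; last exact: moments_indic.
apply: mean_le => //; first by apply: momentsZ; exact: moments_indic.
move=> x; rewrite indicE; case: (boolP (x \in A)) => [/[!inE] /cf|_]; rewrite ?mulr1 ?mulr0//.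
Qed.

End finite_moments.
Arguments mean {d T R} P f.

Section same_law.
Context d (T : measurableType d) d' (T' : measurableType d') d'' (U : measurableType d'')
  (R : realType) (P : probability T R) (Q : probability T' R).
Variables (X : T -> U) (Y : T' -> U).

(** Nonnegative test functions carry no integrability condition, and equality for
them determines the integrals of all measurable functions. *)
Definition eqlaw := forall F : U -> \bar R, measurable_fun setT F ->
  (forall u, 0 <= F u)%E -> (\int[P]_x F (X x) = \int[Q]_y F (Y y))%E.

Hypothesis XY : eqlaw.

Lemma eqlaw_mean (f : U -> R) : measurable_fun setT f ->
  mean P (fun x => f (X x)) = mean Q (fun y => f (Y y)).
Proof.
move=> mf; rewrite /mean /Rintegral; congr fine.
have mf' : measurable_fun setT (EFin \o f) by exact/measurable_EFinP.
have IP : (\int[P]_x (f (X x))%:E =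
    \int[P]_x (EFin \o f)^\+ (X x) - \int[P]_x (EFin \o f)^\- (X x))%E.
  by have := integralE P setT ((EFin \o f) \o X); rewrite funepos_comp funeneg_comp.
have IQ : (\int[Q]_x (f (Y x))%:E =
    \int[Q]_x (EFin \o f)^\+ (Y x) - \int[Q]_x (EFin \o f)^\- (Y x))%E.
  by have := integralE Q setT ((EFin \o f) \o Y); rewrite funepos_comp funeneg_comp.
rewrite IP IQ; congr (_ - _)%E.
- by apply: (XY (measurable_funepos mf')) => u; exact: funepos_ge0.
- by apply: (XY (measurable_funeneg mf')) => u; exact: funeneg_ge0.
Qed.

Hypothesis mX : measurable_fun setT X.

Lemma eqlaw_moments (f : U -> R) : measurable_fun setT f ->
  has_moments Q (fun y => f (Y y)) -> has_moments P (fun x => f (X x)).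
Proof.
move=> mf [_ foo]; split; first exact: measurableT_comp.
move=> k; rewrite (XY (F := fun u => (`|f u| ^+ k)%:E)) ?foo//.
  exact: measurable_normX.
Qed.

End same_law.

Section product.
Context d (T : measurableType d) d' (T' : measurableType d') (R : realType)
  (P : probability T R) (Q : probability T' R).

Lemma eqlaw_fst : eqlaw (P \x Q)%E P fst id.
Proof.
move=> F mF F0; rewrite (fubini_tonelli1 (F \o fst))//=; last exact: measurableT_comp.
by apply: eq_integral => x _; rewrite /fubini_F/= integral_prob_cst.
Qed.

Lemma eqlaw_snd : eqlaw (P \x Q)%E Q snd id.
Proof.
move=> F mF F0; rewrite (fubini_tonelli1 (F \o snd))//=; last exact: measurableT_comp.
by rewrite /fubini_F /= integral_prob_cst.
Qed.

Lemma moments_fst f : has_moments P f -> has_moments (P \x Q)%E (fun p => f p.1).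
Proof. by move=> nf; apply: (eqlaw_moments eqlaw_fst) => //; exact: moments_measurable nf. Qed.

Lemma moments_snd f : has_moments Q f -> has_moments (P \x Q)%E (fun p => f p.2).
Proof. by move=> nf; apply: (eqlaw_moments eqlaw_snd) => //; exact: moments_measurable nf. Qed.

Lemma mean_fst f : has_moments P f -> mean (P \x Q)%E (fun p => f p.1) = mean P f.
Proof. by move=> nf; apply: (eqlaw_mean eqlaw_fst); exact: moments_measurable nf. Qed.

Lemma mean_snd f : has_moments Q f -> mean (P \x Q)%E (fun p => f p.2) = mean Q f.
Proof. by move=> nf; apply: (eqlaw_mean eqlaw_snd); exact: moments_measurable nf. Qed.

Lemma measurable_partial_mean (f : T * T' -> R) : has_moments (P \x Q)%E f ->
  measurable_fun setT (fun x => mean Q (fun y => f (x, y))).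
Proof.
move=> nf.
have := measurable_fubini_F (moments_integrable nf).
by move=> h; apply: (measurableT_comp _ h) => //; exact: fine_measurable.
Qed.

Lemma mean_fubini (f : T * T' -> R) : has_moments (P \x Q)%E f ->
  (forall x, has_moments Q (fun y => f (x, y))) ->
  mean (P \x Q)%E f = mean P (fun x => mean Q (fun y => f (x, y))).
Proof.
move=> nf nfx; rewrite {1 2}/mean /Rintegral; congr fine.
rewrite -integral12_prod_meas1; last exact: moments_integrable.
by apply: eq_integral => x _; rewrite EFin_mean.
Qed.

End product.

(** * Elementary inequalities *)

Section real_inequalities.
Context {R : realType}.
Implicit Types x y : R.

Lemma sin_le_id x : 0 <= x -> sin x <= x.
Proof.
rewrite le_eqVlt => /predU1P[<-|x0]; first by rewrite sin0.
have ctn : {within `[0, x], continuous (@sin R)}.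
  by apply: continuous_subspaceT => z; exact: continuous_sin.
have [c _] := MVT x0 (fun z _ => is_derive_sin z) ctn.
rewrite sin0 !subr0 => ->.
by rewrite -[leRHS]mul1r ler_wpM2r ?cos_le1// ltW.
Qed.

Lemma sin_sqr_le x : sin x ^+ 2 <= x ^+ 2.
Proof.
wlog x0 : x / 0 <= x => [h|].
  have [/h//|x0] := leP 0 x.
  by rewrite -[x ^+ 2]sqrrN -[sin x ^+ 2]sqrrN -sinN h// oppr_ge0 ltW.
have [x1|x1] := leP 1 x.
  rewrite (@le_trans _ _ 1)//; last by rewrite expr_ge1.
have s0 : 0 <= sin x.
  move: x0; rewrite le_eqVlt => /predU1P[<-|x0]; first by rewrite sin0.
  by apply/ltW/sin2_gt0; rewrite x0 (lt_trans x1)// ltr1n.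
by rewrite lerXn2r ?nnegrE ?sin_le_id.
Qed.

Lemma oneBcos_le x : 0 <= 1 - cos x <= x ^+ 2 / 2.
Proof.
rewrite subr_ge0 cos_le1/=.
have e : 1 - cos x = 2 * sin (x / 2) ^+ 2.
  have {1}-> : x = x / 2 + x / 2 by field.
  rewrite cosD; have := cos2Dsin2 (x / 2); lra.
by rewrite e; have := sin_sqr_le (x / 2); rewrite expr_div_n; lra.
Qed.

Lemma expRDN_ge2 x : 2 <= expR x + expR (- x).
Proof.
have := sqr_ge0 (expR (x / 2) - expR (- (x / 2))).
rewrite sqrrB -!expRM_natl -expRD subrr expR0.
have -> : 2%:R * (x / 2) = x by field.
have -> : 2%:R * (- (x / 2)) = - x by field.
lra.
Qed.

Lemma expRBN_ge x : 0 <= x -> 2 * x <= expR x - expR (- x).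
Proof.
rewrite le_eqVlt => /predU1P[<-|x0]; first by rewrite oppr0 subrr mulr0.
pose f (z : R) := expR z - expR (- z).
have df (z : R) : is_derive z (1 : R) f (expR z + expR (- z)).
  rewrite /f; apply: is_derive_eq; rewrite ?scaler1 ?scalerN1 ?scalerN ?opprK/=.
  by rewrite /GRing.scale/=; ring.
have ctn : {within `[0, x], continuous f}.
  by apply: derivable_within_continuous => z _; have := df z => -[].
have [c _] := MVT x0 (fun z _ => df z) ctn.
rewrite {1 2}/f subr0 oppr0 subrr !subr0 => ->.
by apply: ler_wpM2r; [exact: ltW|exact: expRDN_ge2].
Qed.

(** The constants are sharp: together with the exponential moments, this
inequality yields the bound 1 on the second normal moment. *)
Lemma expRDN_ge x : 2 + x ^+ 2 <= expR x + expR (- x).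
Proof.
wlog x0 : x / 0 <= x => [h|].
  have [/h//|x0] := leP 0 x.
  by have := h (- x); rewrite sqrrN opprK (addrC (expR _) (expR x)); apply; rewrite oppr_ge0 ltW.
have x2 : 0 <= x / 2 by rewrite divr_ge0.
have s := expRBN_ge x2.
have e : expR x + expR (- x) = (expR (x / 2) - expR (- (x / 2))) ^+ 2 + 2.
  rewrite sqrrB -!expRM_natl -expRD subrr expR0.
  have -> : 2%:R * (x / 2) = x by field.
  have -> : 2%:R * (- (x / 2)) = - x by field.
  by ring.
have e2 : 2 * (x / 2) = x by field.
rewrite e2 in s.
by rewrite e addrC lerD2r lerXn2r// nnegrE (le_trans x0).
Qed.

Lemma expR_le_quad x : 0 <= x <= 2^-1 -> expR x <= 1 + x + 2 * x ^+ 2.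
Proof.
move=> /andP[x0 x1]; have h := expR_ge1Dx (- x).
have p := expR_gt0 x; have e : expR x * expR (- x) = 1 by rewrite -expRD subrr expR0.
have : expR x * (1 - x) <= 1 by rewrite -[leRHS]e ler_wpM2l// ltW.
move=> h2.
have : expR x * (1 - x) <= (1 + x + 2 * x ^+ 2) * (1 - x).
  apply: (le_trans h2); rewrite -subr_ge0.
  have -> : (1 + x + 2 * x ^+ 2) * (1 - x) - 1 = x ^+ 2 * (1 - 2 * x) by ring.
  by rewrite mulr_ge0 ?sqr_ge0//; lra.
by rewrite ler_pM2r//; lra.
Qed.

Lemma normX_le_expR (k : nat) x : `|x| ^+ k <= k`!%:R * (expR x + expR (- x)).
Proof.
have h : `|x| ^+ k <= k`!%:R * expR `|x|.
  case: k => [|k]; first by rewrite expr0 fact0 mul1r -[leLHS]expR0 ler_expR.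
  have f0 : 0 < (k.+1`!)%:R :> R by rewrite ltr0n fact_gt0.
  rewrite mulrC -ler_pdivrMr//.
  by apply: le_trans (expR_ge1Dxn k (normr_ge0 x)); rewrite lerDr.
apply: (le_trans h); rewrite ler_wpM2l//.
by case: (ger0P x) => _; rewrite ?lerDl ?lerDr expR_ge0.
Qed.

End real_inequalities.

(** * Moments of linear functionals and of the Cameron-Martin density *)

Section normal_moments.
Context {R : realType}.
Local Notation N := (normal_prob (0 : R) 1).

Lemma integral_expR_normal (a : R) : (\int[N]_z (expR (a * z))%:E = (expR (a ^+ 2 / 2))%:E)%E.
Proof.
have := @normal_shift R a (cst 1%E) (measurable_cst _) (fun=> lee01).
rewrite integral_normal_cst => e.
transitivity (\int[N]_z ((expR (a ^+ 2 / 2))%:E * (expR (a * z - a ^+ 2 / 2))%:E))%E.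
  by apply: eq_integral => z _; rewrite -EFinM -expRD; congr ((expR _)%:E); ring.
have e' : (\int[N]_z (expR (a * z - a ^+ 2 / 2))%:E = 1)%E.
  by rewrite [RHS]e; apply: eq_integral => z _; rewrite /= mul1e.
by rewrite ge0_integralZl ?e' ?mule1//; exact: measurable_tilt1.
Qed.

Lemma measurable_expRM (a : R) : measurable_fun [set: measurableTypeR R] (fun z : R => expR (a * z)).
Proof. by apply: measurableT_comp => //; apply: measurable_funM. Qed.

Lemma moments_expR_normal (a : R) : has_moments N (fun z => expR (a * z)).
Proof.
split => [|k]; first exact: measurable_expRM.
under eq_integral do rewrite ger0_norm ?expR_ge0// -expRM_natl mulrA.
by rewrite integral_expR_normal ltry.
Qed.

Lemma moments_id_normal : has_moments N (fun z : R => z).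
Proof.
apply: (@moments_dominated _ _ _ N _ (fun k z => k`!%:R * (expR (1 * z) + expR (- 1 * z)))) => //.
- move=> k; apply: measurable_funM => //.
  by apply: measurable_funD; exact: measurable_expRM.
- by move=> k x; rewrite mul1r mulN1r normX_le_expR.
- move=> k; rewrite -EFin_mean ?ltry//.
  by apply: momentsZ; apply: momentsD; exact: moments_expR_normal.
Qed.

Lemma mean_expR_normal (a : R) : mean N (fun z => expR (a * z)) = expR (a ^+ 2 / 2).
Proof. by rewrite /mean /Rintegral integral_expR_normal. Qed.

Lemma eqlaw_normal_opp : eqlaw N N (fun z : R => - z) (fun z : R => z).
Proof. by move=> F mF F0; exact: normal_opp. Qed.

Lemma mean_id_normal : mean N (fun z : R => z) = 0.
Proof.
have h : mean N (fun z : R => - z) = mean N (fun z : R => z).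
  exact: (eqlaw_mean eqlaw_normal_opp (f := fun z : R => z)).
have h2 : mean N (fun z : R => - z) = - mean N (fun z : R => z).
  under eq_fun do rewrite -mulN1r; rewrite meanZ ?mulN1r//; exact: moments_id_normal.
by move: h; rewrite h2; lra.
Qed.

(** By [expRDN_ge], 2 + l^2 E z^2 <= 2 exp(l^2 / 2) for every l; dividing by l^2
and letting l tend to 0 gives the bound. *)
Lemma mean_sqr_normal_le : mean N (fun z : R => z ^+ 2) <= 1.
Proof.
set m := mean _ _.
have n2 : has_moments N (fun z : R => z ^+ 2) by apply: momentsX; exact: moments_id_normal.
have key (l : R) : 0 < l -> l <= 1 -> m <= 1 + l.
  move=> l0 l1.
  have nl := momentsD (moments_expR_normal l) (moments_expR_normal (- l)).
  have : mean N (fun z : R => 2 + l ^+ 2 * z ^+ 2) <= mean N (fun z => expR (l * z) + expR (- l * z)).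
    apply: mean_le => //.
    - by apply: momentsD; [exact: moments_cst|exact: momentsZ].
    - by move=> z; rewrite mulNr -exprMn expRDN_ge.
  rewrite (meanD (moments_expR_normal l) (moments_expR_normal (- l))) !mean_expR_normal sqrrN.
  rewrite (meanD (moments_cst N 2) (momentsZ (l ^+ 2) n2)) mean_cst meanZ//.
  have q : 0 <= l ^+ 2 / 2 <= 2^-1 by rewrite divr_ge0 ?sqr_ge0//=; nra.
  have := expR_le_quad q => h1 h2.
  have l2 : 0 < l ^+ 2 by rewrite exprn_gt0.
  have : l ^+ 2 * m <= l ^+ 2 * (1 + l).
    have -> : l ^+ 2 * (1 + l) = l ^+ 2 + l ^+ 2 * l by ring.
    have : l ^+ 2 * l ^+ 2 <= l ^+ 2 * l by rewrite ler_pM2l// expr2 -[leRHS]mul1r ler_wpM2r// ltW.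
    by move: h1 h2; rewrite expr_div_n -/m; lra.
  by rewrite ler_pM2l.
rewrite leNgt; apply/negP => m1.
have l0 : 0 < Num.min 1 ((m - 1) / 2) by rewrite lt_min ltr01/= divr_gt0// subr_gt0.
have := key _ l0; rewrite ge_min lexx => /(_ isT).
have : Num.min 1 ((m - 1) / 2) <= (m - 1) / 2 by rewrite ge_min lexx orbT.
lra.
Qed.

Lemma mean_tilt1_normal (l : R) : mean N (fun z => expR (l * z - l ^+ 2 / 2)) = 1.
Proof.
under eq_fun do rewrite expRD mulrC.
by rewrite meanZ ?mean_expR_normal -?expRD ?addNr ?expR0//; exact: moments_expR_normal.
Qed.

Lemma moments_tilt1_normal (l : R) : has_moments N (fun z => expR (l * z - l ^+ 2 / 2)).
Proof.
under eq_fun do rewrite expRD mulrC.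
by apply: momentsZ; exact: moments_expR_normal.
Qed.

(** Under the tilted law z is centered at l.  The shift formula applies to
nonnegative functions, and z is recovered from the squares of z + 1 and z - 1. *)
Lemma mean_id_tilt1_normal (l : R) : mean N (fun z => z * expR (l * z - l ^+ 2 / 2)) = l.
Proof.
have nt := moments_tilt1_normal l.
have ni := moments_id_normal.
have sh (f : R -> R) : measurable_fun setT f -> (forall z, 0 <= f z) ->
    mean N (fun z => f (z + l)) = mean N (fun z => f z * expR (l * z - l ^+ 2 / 2)).
  move=> mf f0; rewrite /mean /Rintegral; congr fine.
  rewrite (normal_shift l (f := EFin \o f))//; exact/measurable_EFinP.
have n1 c : has_moments N (fun z : R => (z + c) ^+ 2) by apply: momentsX; apply: momentsD => //; exact: moments_cst.
have s c := sh (fun z => (z + c) ^+ 2) (moments_measurable (n1 c)) (fun=> sqr_ge0 _).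
have e : mean N (fun z : R => (z + l + 1) ^+ 2) - mean N (fun z : R => (z + l + -1) ^+ 2) = 4 * l.
  rewrite -meanB; [|by under eq_fun do rewrite -addrA; exact: n1..].
  rewrite (_ : (fun x => _) = (fun z => 4 * z + 4 * l)); last by apply/funext => z; ring.
  by rewrite (meanD (momentsZ 4 ni) (moments_cst N (4 * l))) meanZ// mean_id_normal mean_cst mulr0 add0r.
move: e; rewrite (s 1) (s (-1)) -meanB; [|by apply: momentsM..].
rewrite (_ : (fun x => _) = (fun z => 4 * (z * expR (l * z - l ^+ 2 / 2)))); last by apply/funext => z; ring.
rewrite meanZ; last exact: momentsM.
by lra.
Qed.

(** The mean square error of the first order expansion of the Cameron-Martin
density in the shift l.  It is of order l^4 because the terms of order l^2
cancel. *)
Lemma mean_remainder_normal (l : R) :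
  mean N (fun z => (expR (l * z - l ^+ 2 / 2) - 1 - l * z) ^+ 2) <= expR (l ^+ 2) - 1 - l ^+ 2.
Proof.
have nt := moments_tilt1_normal l.
have ni := moments_id_normal.
have nit := momentsM ni nt.
have n2 := momentsX 2 ni.
have nt2 := moments_tilt1_normal (2 * l).
pose D z := expR (l * z - l ^+ 2 / 2).
rewrite (_ : (fun z => _) = (fun z => (expR (l ^+ 2) * expR (2 * l * z - (2 * l) ^+ 2 / 2)
    + (1 + 2 * l * z)) + ((-2) * D z + ((- 2 * l) * (z * D z) + l ^+ 2 * z ^+ 2)))); last first.
  apply/funext => z; rewrite -expRD.
  have -> : l ^+ 2 + (2 * l * z - (2 * l) ^+ 2 / 2) = 2%:R * (l * z - l ^+ 2 / 2) by field.
  by rewrite expRM_natl /D; ring.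
have nc1 : has_moments N (fun z => 1 + 2 * l * z) by apply: momentsD; [exact: moments_cst|exact: momentsZ].
have nA := momentsZ (expR (l ^+ 2)) nt2.
have nB := momentsZ (-2) nt.
have nC := momentsZ (- 2 * l) nit.
have nD := momentsZ (l ^+ 2) n2.
have nCD := momentsD nC nD.
rewrite (meanD (momentsD nA nc1) (momentsD nB nCD)) (meanD nA nc1) (meanD nB nCD) (meanD nC nD).
rewrite (meanD (moments_cst N 1) (momentsZ (2 * l) ni)) mean_cst !meanZ//.
rewrite !mean_tilt1_normal mean_id_tilt1_normal mean_id_normal.
have := mean_sqr_normal_le; set m := mean _ _ => m1.
have : l ^+ 2 * m <= l ^+ 2 by rewrite -[leRHS]mulr1 ler_wpM2l// sqr_ge0.
lra.
Qed.

End normal_moments.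

Section gaussian_moments.
Context {R : realType}.
Local Notation N := (normal_prob (0 : R) 1).
Local Notation G n := (gaussian R n).
Local Notation G2 n := (gaussian R n \x gaussian R n)%E.

Lemma eqlaw_rotation n (c s : R) : c ^+ 2 + s ^+ 2 = 1 -> c != -1 ->
  eqlaw (G2 n) (G2 n)
    (fun p => (lincomb c p.1 s p.2, lincomb (- s) p.1 c p.2)) id.
Proof.
move=> cs c1 F mF F0.
have mR : measurable_fun setT
    (fun p : n.-tuple R * n.-tuple R => F (lincomb c p.1 s p.2, lincomb (- s) p.1 c p.2)).
  apply: measurableT_comp => //.
  by apply: measurable_fun_pair; exact: measurable_fun_lincomb.
apply: (etrans (fubini_tonelli1 _ mR (fun=> F0 _))).
apply: (etrans _ (esym (fubini_tonelli1 _ mF F0))).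
exact: gaussian_rotation.
Qed.

Lemma eqlaw_lincomb n (c s : R) : c ^+ 2 + s ^+ 2 = 1 -> c != -1 ->
  eqlaw (G2 n) (G n) (fun p => lincomb c p.1 s p.2) id.
Proof.
move=> cs c1 F mF F0.
have mR : measurable_fun setT
    (fun p : n.-tuple R * n.-tuple R => F (lincomb c p.1 s p.2)).
  by apply: measurableT_comp => //; exact: measurable_fun_lincomb.
apply: (etrans (fubini_tonelli1 _ mR (fun=> F0 _))).
exact: gaussian_lincomb.
Qed.

Lemma eqlaw_dot n (a : n.-tuple R) :
  eqlaw (G n) N (dot a) (fun z => Num.sqrt (dot a a) * z).
Proof. by move=> F mF F0; exact: gaussian_dot. Qed.

Lemma measurable_dot n (a : n.-tuple R) : measurable_fun setT (dot a).
Proof. exact: measurable_fun_dot. Qed.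

Lemma moments_dot n (a : n.-tuple R) : has_moments (G n) (dot a).
Proof.
apply: (eqlaw_moments (eqlaw_dot a) (measurable_dot a) (f := id)) => //.
by apply: momentsZ; exact: moments_id_normal.
Qed.

Lemma moments_tilt n (v : n.-tuple R) : has_moments (G n) (tilt v).
Proof.
apply: (eqlaw_moments (eqlaw_dot v) (measurable_dot v) (f := fun z => expR (z - dot v v / 2))).
  by apply: measurableT_comp => //; exact: measurable_funB.
have := moments_tilt1_normal (Num.sqrt (dot v v)).
by rewrite sqr_sqrtr ?dot_ge0.
Qed.

Lemma mean_dot n (a : n.-tuple R) : mean (G n) (dot a) = 0.
Proof.
rewrite (eqlaw_mean (eqlaw_dot a) (f := id))// meanZ ?mean_id_normal ?mulr0//.
exact: moments_id_normal.
Qed.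

Lemma mean_dot_sqr_le n (a : n.-tuple R) : mean (G n) (fun x => dot a x ^+ 2) <= dot a a.
Proof.
rewrite (eqlaw_mean (eqlaw_dot a) (f := fun z => z ^+ 2)); last exact: measurable_funX.
under eq_fun do rewrite exprMn sqr_sqrtr ?dot_ge0//.
rewrite meanZ; last by apply: momentsX; exact: moments_id_normal.
by rewrite -[leRHS]mulr1 ler_wpM2l ?dot_ge0// mean_sqr_normal_le.
Qed.

Lemma mean_remainder n (v : n.-tuple R) : dot v v <= 2^-1 ->
  mean (G n) (fun x => (tilt v x - 1 - dot v x) ^+ 2) <= 2 * dot v v ^+ 2.
Proof.
move=> v1.
rewrite (eqlaw_mean (eqlaw_dot v) (f := fun z => (expR (z - dot v v / 2) - 1 - z) ^+ 2)); last first.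
  apply: measurable_funX; apply: measurable_funB => //; apply: measurable_funB => //.
  by apply: measurableT_comp => //; exact: measurable_funB.
have := mean_remainder_normal (Num.sqrt (dot v v)).
rewrite sqr_sqrtr ?dot_ge0// => h; apply: (le_trans h).
have q : 0 <= dot v v <= 2^-1 by rewrite dot_ge0.
by have := expR_le_quad q; lra.
Qed.

Lemma moments_tnth n i : has_moments (G n) (fun x => tnth x i).
Proof.
pose e : n.-tuple R := [tuple (j == i)%:R | j < n].
have -> : (fun x : n.-tuple R => tnth x i) = dot e.
  apply/funext => x; rewrite /dot (bigD1 i)//= tnth_mktuple eqxx mul1r.
  by rewrite big1 ?addr0// => j /negbTE ji; rewrite tnth_mktuple ji mul0r.
exact: moments_dot.
Qed.

Lemma moments_dotself n : has_moments (G n) (fun x => dot x x).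
Proof. by apply: moments_sum => i; apply: momentsM; exact: moments_tnth. Qed.

Lemma mean_shift n (v : n.-tuple R) (f : n.-tuple R -> R) :
  measurable_fun setT f -> (forall x, 0 <= f x) ->
  mean (G n) (fun x => f (lincomb 1 x 1 v)) = mean (G n) (fun x => f x * tilt v x).
Proof.
move=> mf f0; rewrite /mean /Rintegral; congr fine.
by apply: (gaussian_shift v (F := EFin \o f)) => //; exact/measurable_EFinP.
Qed.

End gaussian_moments.

(** * Half-spaces and the measurability of the half-space correlation *)

Lemma mean_bounded_cvg d (T : measurableType d) (R : realType) (P : probability T R)
    (f_ : nat -> T -> R) (f : T -> R) :
  (forall j, measurable_fun setT (f_ j)) -> measurable_fun setT f ->
  (forall x, f_ j x @[j --> \oo] --> f x) -> (forall j x, `|f_ j x| <= 1) ->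
  mean P (f_ j) @[j --> \oo] --> mean P f.
Proof.
move=> mf_ mf cf f1.
have i1 : P.-integrable setT (EFin \o cst (1 : R)).
  by apply: moments_integrable; exact: moments_cst.
have fl1 x : `|f x| <= 1.
  have c : `|f_ j x| @[j --> \oo] --> `|f x| by apply: cvg_norm; exact: cf.
  rewrite -(cvg_lim _ c)//; apply: limr_le; first by apply/cvg_ex; exists `|f x|.
  by apply: nearW => j; exact: f1.
have nf_ j : has_moments P (f_ j) by apply: moments_bounded (f1 j).
have nf : has_moments P f by apply: moments_bounded fl1.
have [||||_ _ h] := @dominated_convergence _ _ _ P setT measurableT
  (fun j => EFin \o f_ j) (EFin \o f) (EFin \o cst 1) _ _ _ i1 _.
- by move=> j; exact/measurable_EFinP.
- exact/measurable_EFinP.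
- by apply: aeW => x _ /=; apply: cvg_EFin; [exact: nearW|exact: cf].
- by apply: aeW => x j _; rewrite /= lee_fin.
by apply: fine_cvg; rewrite -EFin_mean in h.
Qed.

Section halfspaces.
Context {R : realType}.
Local Notation G n := (gaussian R n).

(** The parameters that [half_space] hides behind existential quantifiers. *)
Definition hspace n (a : n.-tuple R) (b : R) : set (n.-tuple R) := [set x | dot x a <= b].

Lemma hspace_half_space n (a : n.-tuple R) b : half_space (hspace a b).
Proof. by exists a, b. Qed.

Lemma measurable_hspace n (a : n.-tuple R) b : measurable (hspace a b).
Proof.
have m : measurable_fun setT (fun x : n.-tuple R => dot x a) by exact: measurable_fun_dot.
have := m measurableT _ (measurable_itv `]-oo, b]); rewrite setTI; congr measurable.
Qed.

Definition cov n (A C : set (n.-tuple R)) : R :=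
  mean (G n) (fun x => \1_A x * \1_C x) - mean (G n) (\1_A) * mean (G n) (\1_C).

Lemma covE n (A C : set (n.-tuple R)) : measurable A -> measurable C ->
  covariance (G n) \1_A \1_C = (cov A C)%:E.
Proof. by move=> mA mC; rewrite covariance_mean//; exact: moments_indic. Qed.

(** Rational half-spaces indexed by nat, so that countable unions and limits range
over the index; a number that decodes to nothing gives the whole space. *)
Definition rational_hspace n (k : nat) : set (n.-tuple R) :=
  let p : n.-tuple rat * rat := odflt ([tuple 0 | i < n], 0) (unpickle k) in
  hspace [tuple ratr (tnth p.1 i) | i < n] (ratr p.2).

Arguments rational_hspace n k : clear implicits.

Lemma rational_hspaceP n (q : n.-tuple rat) (r : rat) :
  exists k, rational_hspace n k = hspace [tuple ratr (tnth q i) | i < n] (ratr r).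
Proof. by exists (pickle (q, r)); rewrite /rational_hspace pickleK. Qed.

Lemma measurable_rational_hspace n k : measurable (rational_hspace n k).
Proof. exact: measurable_hspace. Qed.

(** Indicators converge at every point, boundary hyperplane included, because the
offsets approach b from above at a slower rate than the normals approach a. *)
Lemma hspace_rational_approx n (a : n.-tuple R) b :
  exists k : nat -> nat, forall x, \forall j \near \oo, \1_(rational_hspace n (k j)) x = \1_(hspace a b) x :> R.
Proof.
pose d (j : nat) : R := j.+1%:R^-1.
have d0 j : 0 < d j by rewrite invr_gt0.
have ha j i : exists q : rat, `|ratr q - tnth a i| <= d j ^+ 2.
  have : tnth a i - d j ^+ 2 < tnth a i + d j ^+ 2.
    have : 0 < d j ^+ 2 by rewrite exprn_gt0.
    by lra.
  move=> /rat_in_itvoo[q]; rewrite in_itv/= => /andP[q1 q2].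
  by exists q; rewrite ler_norml; apply/andP; split; lra.
have hb j : exists q : rat, b + d j <= ratr q <= b + 2 * d j.
  have : b + d j < b + 2 * d j by have := d0 j; lra.
  move=> /rat_in_itvoo[q]; rewrite in_itv/= => /andP[q1 q2].
  by exists q; rewrite !ltW.
have /choice[k hk] : forall j, exists k, exists a' b', [/\ rational_hspace n k = hspace a' b',
    forall i, `|tnth a' i - tnth a i| <= d j ^+ 2 & b + d j <= b' <= b + 2 * d j].
  move=> j; have /choice[q hq] := ha j; have [r hr] := hb j.
  have [k hk] := rational_hspaceP [tuple q i | i < n] r.
  exists k, [tuple ratr (q i) | i < n], (ratr r); split => //.
    rewrite hk; congr hspace; apply: eq_from_tnth => i; by rewrite !tnth_mktuple.
  by move=> i; rewrite tnth_mktuple.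
exists k => x.
pose S := \sum_(i < n) `|tnth x i|.
have S0 : 0 <= S by apply: sumr_ge0.
have bound j a' : (forall i, `|tnth a' i - tnth a i| <= d j ^+ 2) ->
    S <= j.+1%:R -> `|dot x a' - dot x a| <= d j.
  move=> h Sj; rewrite /dot -sumrB.
  apply: (le_trans (ler_norm_sum _ _ _)).
  apply: (@le_trans _ _ (\sum_(i < n) `|tnth x i| * d j ^+ 2)).
    by apply: ler_sum => i _; rewrite -mulrBr normrM ler_wpM2l.
  rewrite -mulr_suml -/S expr2 mulrA -[leRHS]mul1r; apply: ler_wpM2r; first exact: ltW.
  by rewrite ler_pdivrMr ?mul1r.
have near_S : \forall j \near \oo, S <= j.+1%:R.
  near=> j; apply: (@le_trans _ _ j%:R); last by rewrite ler_nat.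
  by near: j; exact: nbhs_infty_ger.
have [xb|xb] := leP (dot x a) b.
  near=> j; have [a' [b' [-> h1 /andP[h2 _]]]] := hk j.
  have Sj : S <= j.+1%:R by near: j.
  have := bound j a' h1 Sj; rewrite ler_norml => /andP[_ h3].
  by rewrite !indicE !mem_set// /hspace/=; lra.
have near_g : \forall j \near \oo, 3 * d j < dot x a - b.
  have g0 : 0 < (dot x a - b) / 3 by rewrite divr_gt0// subr_gt0.
  have := near_infty_natSinv_lt (PosNum g0); apply: filterS => j /=.
  by rewrite -/(d j) ltr_pdivlMr// mulrC.
near=> j; have [a' [b' [-> h1 /andP[_ h2]]]] := hk j.
have Sj : S <= j.+1%:R by near: j.
have gj : 3 * d j < dot x a - b by near: j.
have := bound j a' h1 Sj; rewrite ler_norml => /andP[h3 _].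
rewrite !indicE !memNset// /hspace/= => h4; lra.
Unshelve. all: by end_near. Qed.

Lemma indic_le1 n (A : set (n.-tuple R)) x : `|\1_A x| <= 1 :> R.
Proof. by rewrite indicE; case: (_ \in _); rewrite ?normr1 ?normr0. Qed.

Lemma cov_rational n (a : n.-tuple R) b (C : set (n.-tuple R)) r :
  measurable C -> r < cov (hspace a b) C -> exists k, r < cov (rational_hspace n k) C.
Proof.
move=> mC rc; apply: contrapT => /forallNP h.
have {}h k : cov (rational_hspace n k) C <= r by rewrite leNgt; apply/negP.
have [k hk] := hspace_rational_approx a b.
have mi (A : set (n.-tuple R)) : measurable A -> measurable_fun setT (\1_A : _ -> R).
  by move=> mA; exact: measurable_indic.
have c1 : mean (G n) (\1_(rational_hspace n (k j))) @[j --> \oo] --> mean (G n) (\1_(hspace a b)).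
  apply: mean_bounded_cvg.
  - by move=> j; apply: mi; exact: measurable_rational_hspace.
  - by apply: mi; exact: measurable_hspace.
  - move=> x; apply: cvg_near_cst; exact: hk.
  - by move=> j x; exact: indic_le1.
have c2 : mean (G n) (fun x => \1_(rational_hspace n (k j)) x * \1_C x) @[j --> \oo] -->
    mean (G n) (fun x => \1_(hspace a b) x * \1_C x).
  apply: mean_bounded_cvg.
  - by move=> j; apply: measurable_funM; apply: mi => //; exact: measurable_rational_hspace.
  - by apply: measurable_funM; apply: mi => //; exact: measurable_hspace.
  - move=> x; apply: cvgMr_tmp.
    apply: cvg_near_cst; exact: hk.
  - by move=> j x; rewrite normrM mulr_ile1// indic_le1.
have c : cov (rational_hspace n (k j)) C @[j --> \oo] --> cov (hspace a b) C.
  by apply: cvgB => //; apply: cvgMr_tmp.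
have : cov (hspace a b) C <= r.
  rewrite -(cvg_lim _ c)//; apply: limr_le; first by apply/cvg_ex; exists (cov (hspace a b) C).
  by apply: nearW => j; exact: h.
by rewrite leNgt rc.
Qed.

Lemma half_space_corr_gt n (C : set (n.-tuple R)) r : measurable C ->
  (r%:E < half_space_corr C)%E <-> exists k, r < cov (rational_hspace n k) C.
Proof.
move=> mC; split.
  move=> /ereal_sup_gt[_ [A [a [b ->]] <-]].
  by rewrite -/(hspace a b) covE ?lte_fin//; [exact: cov_rational|exact: measurable_hspace].
move=> [k rk]; apply: (@lt_le_trans _ _ (cov (rational_hspace n k) C)%:E); first by rewrite lte_fin.
apply: ereal_sup_ubound; exists (rational_hspace n k); first exact: hspace_half_space.
by rewrite covE//; exact: measurable_rational_hspace.
Qed.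

Section restrictions.
Variables (n : nat) (B : set (n.-tuple R)) (mB : measurable B) (t : R).
Let sg := Num.sqrt (1 - expR (- (2 * t))).
Let rh := expR (- t).

Lemma indic_restriction y x : \1_(restriction B t y) x = \1_B (lincomb sg x rh y) :> R.
Proof. by []. Qed.

Lemma measurable_restriction y : measurable (restriction B t y).
Proof.
have m : measurable_fun setT (fun x : n.-tuple R => lincomb sg x rh y).
  exact: measurable_fun_lincomb.
by have := m measurableT _ mB; rewrite setTI.
Qed.

Lemma moments_indic_comp d (T : measurableType d) (P : probability T R) (g : T -> n.-tuple R)
  (A : set (n.-tuple R)) :
  measurable A -> measurable_fun setT g -> has_moments P (fun x => \1_A (g x)).
Proof.
move=> mA mg; apply: (@moments_bounded _ _ _ _ _ 1) => [|x]; last exact: indic_le1.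
by apply: measurableT_comp => //; exact: measurable_indic.
Qed.

Lemma measurable_cov_restriction A : measurable A ->
  measurable_fun setT (fun y => cov A (restriction B t y)).
Proof.
move=> mA.
have nB : has_moments (G n \x G n)%E (fun p => \1_B (lincomb sg p.2 rh p.1)).
  by apply: moments_indic_comp => //; exact: measurable_fun_lincomb.
have nAB : has_moments (G n \x G n)%E (fun p => \1_A p.2 * \1_B (lincomb sg p.2 rh p.1)).
  by apply: momentsM => //; exact: moments_indic_comp.
apply: measurable_funB; first exact: (measurable_partial_mean nAB).
by apply: measurable_funM => //; exact: (measurable_partial_mean nB).
Qed.

(** The supremum over all half-spaces is a supremum over countably many, and each
covariance is a measurable function of y by Fubini. *)
Lemma measurable_correlated (e : R) :
  measurable [set y | (e%:E <= half_space_corr (restriction B t y))%E].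
Proof.
rewrite (_ : [set y | _] = \bigcap_m \bigcup_k
    [set y | e - m.+1%:R^-1 < cov (rational_hspace n k) (restriction B t y)]).
  apply: bigcapT_measurable => m; apply: bigcupT_measurable => k.
  have := measurable_cov_restriction (@measurable_rational_hspace n k).
  move=> /(_ measurableT _ (measurable_itv `](e - m.+1%:R^-1), +oo[)).
  rewrite setTI; congr measurable.
  by apply/seteqP; split => x /=; rewrite in_itv/= andbT.
apply/seteqP; split => [y ey m _|y h].
  have /half_space_corr_gt : ((e - m.+1%:R^-1)%:E < half_space_corr (restriction B t y))%E.
    by apply: lt_le_trans ey; rewrite lte_fin ltrBlDr ltrDl invr_gt0.
  by move=> /(_ (measurable_restriction y))[k]; exists k.
rewrite /=; apply/lee_addgt0Pr => d d0.
have := near_infty_natSinv_lt (PosNum d0) => -[m _ /(_ m (leqnn _))/= md].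
have [k _ /= kh] := h m I.
rewrite -leeBlDr//; apply/ltW/half_space_corr_gt; first exact: measurable_restriction.
by exists k; apply: le_lt_trans kh; rewrite lerD2l lerN2 ltW.
Qed.

End restrictions.

End halfspaces.

(** * Smoothing operators and noise stability of half-spaces *)

Section smoothing.
Context {R : realType}.
Local Notation N := (normal_prob (0 : R) 1).
Local Notation G n := (gaussian R n).
Local Notation G2 n := (gaussian R n \x gaussian R n)%E.

Definition unit_fun d (T : measurableType d) (f : T -> R) :=
  measurable_fun setT f /\ forall x, 0 <= f x <= 1.

Lemma unit_fun_indic d (T : measurableType d) (A : set T) :
  measurable A -> unit_fun (\1_A : T -> R).
Proof.
move=> mA; split; first exact: measurable_indic.
by move=> x; rewrite indicE; case: (_ \in _); rewrite ?lexx ?ler01.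
Qed.

Lemma unit_fun_comp d (T : measurableType d) d' (T' : measurableType d')
  (f : T' -> R) (g : T -> T') :
  unit_fun f -> measurable_fun setT g -> unit_fun (fun x => f (g x)).
Proof. by move=> [mf f01] mg; split; [exact: measurableT_comp|]. Qed.

Lemma moments_unit d (T : measurableType d) (P : probability T R) (f : T -> R) :
  unit_fun f -> has_moments P f.
Proof.
move=> [mf f01]; apply: (moments_bounded _ (C := 1)) => // x.
by have /andP[? ?] := f01 x; rewrite ger0_norm.
Qed.

Lemma mean_unit d (T : measurableType d) (P : probability T R) (f : T -> R) :
  unit_fun f -> 0 <= mean P f <= 1.
Proof.
move=> uf; have nf := moments_unit P uf; case: uf => _ f01.
rewrite mean_ge0 => [|x]; last by have /andP[] := f01 x.
rewrite -[leRHS](mean_cst P 1); apply: mean_le => // [|x]; first exact: moments_cst.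
by have /andP[] := f01 x.
Qed.

Lemma moments_norm d (T : measurableType d) (P : probability T R) (f : T -> R) :
  has_moments P f -> has_moments P (fun x => `|f x|).
Proof.
move=> nf; apply: (moments_le _ nf) => [|x]; last by rewrite normr_id.
by apply: measurableT_comp => //; exact: moments_measurable nf.
Qed.

Lemma unit_partial_mean d (T : measurableType d) d' (T' : measurableType d')
  (P : probability T R) (Q : probability T' R) (K : T * T' -> R) :
  unit_fun K -> unit_fun (fun x => mean Q (fun y => K (x, y))).
Proof.
move=> uK; split; first exact: (@measurable_partial_mean _ _ _ _ R P Q _ (moments_unit _ uK)).
by move=> x; apply: mean_unit; apply: unit_fun_comp uK _.
Qed.

Lemma unit_sqr_dist d (T : measurableType d) (h : T -> R) m :
  unit_fun h -> 0 <= m <= 1 -> unit_fun (fun x => (h x - m) ^+ 2).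
Proof.
move=> [mh h01] /andP[m0 m1]; split.
  by apply: measurable_funX; exact: measurable_funB.
by move=> x; have /andP[? ?] := h01 x; rewrite sqr_ge0/=; nra.
Qed.

(** The Ornstein-Uhlenbeck operator at time t is the case r = exp(-t),
s^2 = 1 - r^2; compositions are computed with the coefficients. *)
Definition smooth n (r s : R) (f : n.-tuple R -> R) (x : n.-tuple R) : R :=
  mean (G n) (fun z => f (lincomb r x s z)).

Lemma measurable_lincomb_pair n (a b : R) :
  measurable_fun setT (fun p : n.-tuple R * n.-tuple R => lincomb a p.1 b p.2).
Proof. exact: measurable_fun_lincomb. Qed.

Lemma unit_smooth n r s (f : n.-tuple R -> R) : unit_fun f -> unit_fun (smooth r s f).
Proof.
move=> uf.
have u2 : unit_fun (fun p : n.-tuple R * n.-tuple R => f (lincomb r p.1 s p.2)).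
  exact: unit_fun_comp uf (measurable_lincomb_pair r s).
split; first exact: (@measurable_partial_mean _ _ _ _ R (G n) (G n) _ (moments_unit _ u2)).
move=> x; apply: mean_unit.
by apply: unit_fun_comp uf _; exact: measurable_fun_lincomb.
Qed.

Definition gaussian_var n (h : n.-tuple R -> R) : R := mean (G n) (fun x => (h x - mean (G n) h) ^+ 2).

(** Smoothing with coefficients r', s' is smoothing with r, s followed by averaging
at correlation c, and averaging does not increase the variance by Jensen's
inequality. *)
Lemma var_smooth_le n (r s r' s' c d : R) (f : n.-tuple R -> R) : unit_fun f ->
  r' = r * c -> c ^+ 2 + d ^+ 2 = 1 -> 0 <= c ->
  s' ^+ 2 = (r * d) ^+ 2 + s ^+ 2 -> 0 < s' -> 0 <= r -> 0 <= d ->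
  gaussian_var (smooth r' s' f) <= gaussian_var (smooth r s f).
Proof.
move=> uf r'E cd c0 s'E s'0 r0 d0.
pose h := smooth r s f.
have uh : unit_fun h by exact: unit_smooth.
have c1 : c != -1 by rewrite gt_eqF// (lt_le_trans _ c0)// oppr_lt0.
have smE y : smooth r' s' f y = mean (G n) (fun z => h (lincomb c y d z)).
  have uF : unit_fun (fun p : n.-tuple R * n.-tuple R =>
      f (lincomb r (lincomb c y d p.1) s p.2)).
    by apply: unit_fun_comp uf _; do 2 apply: measurable_fun_lincomb => //.
  rewrite -(@mean_fubini _ _ _ _ _ (G n) (G n) (fun p => f (lincomb r (lincomb c y d p.1) s p.2))).
  - have q : (r * d / s') ^+ 2 + (s / s') ^+ 2 = 1.
      by rewrite !expr_div_n -mulrDl -s'E divff// expf_neq0// gt_eqF.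
    have q1 : r * d / s' != -1.
      rewrite gt_eqF// (@lt_le_trans _ _ 0) ?oppr_lt0//.
      by rewrite divr_ge0 ?mulr_ge0// ltW.
    have ml : measurable_fun setT (fun z : n.-tuple R => f (lincomb r' y s' z)).
      by case: (unit_fun_comp uf (g := fun z => lincomb r' y s' z)) => //; exact: measurable_fun_lincomb.
    rewrite /smooth -(eqlaw_mean (eqlaw_lincomb (n := n) q q1) (f := fun z => f (lincomb r' y s' z)))//.
    congr mean; apply/funext => p; congr f; apply: eq_from_tnth => i.
    rewrite !tnth_lincomb r'E; field; exact: lt0r_neq0.
  - exact: moments_unit.
  - move=> x /=; apply: moments_unit; apply: unit_fun_comp uf _; by apply: measurable_fun_lincomb.
have mE : mean (G n) (smooth r' s' f) = mean (G n) h.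
  have uh2 : unit_fun (fun p : n.-tuple R * n.-tuple R => h (lincomb c p.1 d p.2)).
    exact: unit_fun_comp uh (measurable_lincomb_pair c d).
  rewrite (funext smE).
  rewrite -(mean_fubini (f := fun p => h (lincomb c p.1 d p.2)))//.
  - by rewrite (eqlaw_mean (eqlaw_lincomb (n := n) cd c1))//; case: uh.
  - exact: moments_unit.
  - by move=> x /=; apply: moments_unit; apply: unit_fun_comp uh _; by apply: measurable_fun_lincomb.
rewrite /gaussian_var mE -/h; set m := mean _ h.
have nhm : has_moments (G n) (fun x => (h x - m) ^+ 2).
  by apply: momentsX; apply: momentsB; [exact: moments_unit|exact: moments_cst].
have n2 : has_moments (G2 n) (fun p => (h (lincomb c p.1 d p.2) - m) ^+ 2).
  exact: (eqlaw_moments (eqlaw_lincomb (n := n) cd c1) (measurable_lincomb_pair c d) (moments_measurable nhm)).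
have nx x : has_moments (G n) (fun z => h (lincomb c x d z) - m).
  apply: momentsB; last exact: moments_cst.
  by apply: moments_unit; apply: unit_fun_comp uh _; exact: measurable_fun_lincomb.
have := eqlaw_mean (eqlaw_lincomb (n := n) cd c1) (moments_measurable nhm) => /= <-.
rewrite (mean_fubini n2); last by move=> x; apply: momentsX; exact: nx.
have us : unit_fun (smooth r' s' f) by exact: unit_smooth.
apply: mean_le.
- by apply: momentsX; apply: momentsB; [exact: moments_unit|exact: moments_cst].
- apply: moments_unit; apply: (unit_partial_mean (G n) (G n) (K := fun p => (h (lincomb c p.1 d p.2) - m) ^+ 2)).
  apply: (unit_fun_comp (f := fun x => (h x - m) ^+ 2)); last exact: measurable_lincomb_pair.
  by apply: unit_sqr_dist => //; exact: mean_unit.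
move=> y; rewrite smE.
have -> : mean (G n) (fun z => h (lincomb c y d z)) - m = mean (G n) (fun z => h (lincomb c y d z) - m).
  have nz : has_moments (G n) (fun z => h (lincomb c y d z)).
    by apply: moments_unit; apply: unit_fun_comp uh _; exact: measurable_fun_lincomb.
  by rewrite (meanB nz (moments_cst (G n) m)) mean_cst.
exact: mean_sqr_le.
Qed.

Lemma ou_smooth n t (f : n.-tuple R -> R) :
  ou_semigroup t f = smooth (expR (- t)) (Num.sqrt (1 - expR (- (2 * t)))) f.
Proof. by apply/funext => x; rewrite /ou_semigroup unlock. Qed.

Lemma variance_ou n t (f : n.-tuple R -> R) : unit_fun f ->
  ('V_(G n)[ou_semigroup t f] =
    (gaussian_var (smooth (expR (- t)) (Num.sqrt (1 - expR (- (2 * t)))) f))%:E)%E.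
Proof. by move=> uf; rewrite ou_smooth variance_mean//; apply: moments_unit; exact: unit_smooth. Qed.

Lemma ou_coef (t : R) : 0 < t -> [/\ 0 < expR (- t), expR (- t) < 1,
  0 < Num.sqrt (1 - expR (- (2 * t))) &
  expR (- t) ^+ 2 + Num.sqrt (1 - expR (- (2 * t))) ^+ 2 = 1].
Proof.
move=> t0; have h : expR (- (2 * t)) = expR (- t) ^+ 2 by rewrite -expRM_natl mulrN.
have l1 : expR (- (2 * t)) < 1 by rewrite expR_lt1 oppr_lt0 mulr_gt0.
split; rewrite ?expR_gt0 ?expR_lt1 ?oppr_lt0 ?sqrtr_gt0 ?subr_gt0//.
by rewrite sqr_sqrtr ?h ?subrKC// -h subr_ge0 ltW.
Qed.

Lemma ou_var_antitone n (t u : R) (f : n.-tuple R -> R) : unit_fun f -> 0 < u -> u <= t ->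
  ('V_(G n)[ou_semigroup t f] <= 'V_(G n)[ou_semigroup u f])%E.
Proof.
move=> uf u0; rewrite le_eqVlt => /predU1P[->//|ut].
rewrite (variance_ou t uf) (variance_ou u uf) lee_fin.
have t0 : 0 < t by exact: lt_trans ut.
have [rt0 rt1 st0 rst] := ou_coef t0; have [ru0 ru1 su0 rsu] := ou_coef u0.
have tu0 : 0 < t - u by rewrite subr_gt0.
have [c0 c1 d0 cd] := ou_coef tu0.
move: rst rsu cd st0 su0 d0; set st := Num.sqrt _; set su := Num.sqrt _; set d := Num.sqrt _.
move=> rst rsu cd st0 su0 d0.
have e : expR (- t) = expR (- u) * expR (- (t - u)) by rewrite -expRD; congr expR; ring.
apply: (@var_smooth_le n _ _ _ _ (expR (- (t - u))) d) => //; rewrite ?ltW//.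
have -> : st ^+ 2 = 1 - expR (- t) ^+ 2 by rewrite -rst; ring.
have -> : su ^+ 2 = 1 - expR (- u) ^+ 2 by rewrite -rsu; ring.
rewrite exprMn; have -> : d ^+ 2 = 1 - expR (- (t - u)) ^+ 2 by rewrite -cd; ring.
by rewrite e; ring.
Qed.

Lemma mem_hspace n (a : n.-tuple R) b x : (x \in hspace a b) = (dot x a <= b).
Proof. by apply/idP/idP => [/set_mem|/mem_set]. Qed.

(** If the indicator of {<a, x> <= b} takes different values at X and at its noisy
copy X', then either <a, X> is within k |a| of b, which has probability at most
2 k, or |<a, X' - X>| exceeds k |a|, which Chebyshev's inequality bounds by
4 (1 - c) / k^2.  Both terms are at most e / 2 for k = e / 4 and
1 - c = k^2 e / 8. *)
Lemma half_space_stable (e : R) : 0 < e -> e <= 1 ->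
  exists c d, [/\ 0 < c, c < 1, 0 < d, c ^+ 2 + d ^+ 2 = 1 &
   forall n (a : n.-tuple R) b,
    mean (G2 n) (fun p => `|\1_(hspace a b) p.1 - \1_(hspace a b) (lincomb c p.1 d p.2)|) <= e].
Proof.
move=> e0 e1.
pose k := e / 4; have k0 : 0 < k by rewrite divr_gt0.
pose q := k ^+ 2 * e / 8.
have q0 : 0 < q by rewrite divr_gt0// mulr_gt0// exprn_gt0.
have q1 : q < 2^-1.
  have k1 : k <= 1 by rewrite /k; lra.
  have k2 : k ^+ 2 <= 1 by rewrite expr_le1// ltW.
  have : k ^+ 2 * e <= 1 by rewrite mulr_ile1// ltW// exprn_gt0.
  by rewrite /q; lra.
pose c := 1 - q; pose d := Num.sqrt (1 - c ^+ 2).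
have c0 : 0 < c by rewrite /c; lra.
have c1 : c < 1 by rewrite /c; lra.
have d2 : 0 < 1 - c ^+ 2 by rewrite subr_gt0 expr_lt1// ltW.
have cd : c ^+ 2 + d ^+ 2 = 1 by rewrite sqr_sqrtr ?subrKC// ltW.
exists c, d; split => //; first by rewrite sqrtr_gt0.
move=> n a b; pose r := Num.sqrt (dot a a).
have r2 : r ^+ 2 = dot a a by rewrite sqr_sqrtr// dot_ge0.
have uA : unit_fun (\1_(hspace a b) : n.-tuple R -> R) by apply: unit_fun_indic; exact: measurable_hspace.
have nA1 : has_moments (G2 n) (fun p => \1_(hspace a b) p.1) by apply: moments_fst; exact: moments_unit.
have nA2 : has_moments (G2 n) (fun p => \1_(hspace a b) (lincomb c p.1 d p.2)).
  by apply: moments_unit; exact: unit_fun_comp uA (measurable_lincomb_pair c d).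
have [a0|a0] := eqVneq (dot a a) 0.
  have da x : dot x a = 0.
    have ai i : tnth a i = 0.
      move: a0 => /eqP; rewrite psumr_eq0 => [|j _]; last by rewrite -expr2 sqr_ge0.
      by move=> /allP/(_ i (mem_index_enum _)); rewrite mulf_eq0 orbb => /eqP.
    by rewrite /dot big1// => i _; rewrite ai mulr0.
  rewrite (_ : (fun p => _) = fun=> 0) ?mean_cst ?ltW//.
  by apply/funext => p; rewrite !indicE !mem_hspace !da subrr normr0.
have rp : 0 < r by rewrite sqrtr_gt0 lt_def a0 dot_ge0.
pose J (u : R) : R := \1_(`[b - k * r, b + k * r]%classic) u.
have uJ : unit_fun J by exact: unit_fun_indic.
pose L (p : n.-tuple R * n.-tuple R) := (c - 1) * dot a p.1 + d * dot a p.2.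
have n1 : has_moments (G2 n) (fun p => dot a p.1) by apply: moments_fst; exact: moments_dot.
have n2 : has_moments (G2 n) (fun p => dot a p.2) by apply: moments_snd; exact: moments_dot.
have n12 := momentsX 2 n1; have n22 := momentsX 2 n2.
have uJd : unit_fun (fun x : n.-tuple R => J (dot a x)).
  exact: unit_fun_comp uJ (measurable_dot a).
have nJ : has_moments (G2 n) (fun p => J (dot a p.1)) := moments_fst (G n) (moments_unit (G n) uJd).
pose K := (k * r) ^- 2.
have K0 : 0 < K by rewrite invr_gt0 exprn_gt0// mulr_gt0.
have nU := momentsD (momentsZ (2 * (c - 1) ^+ 2) n12) (momentsZ (2 * d ^+ 2) n22).
apply: (@le_trans _ _ (mean (G2 n) (fun p => J (dot a p.1) +
   K * (2 * (c - 1) ^+ 2 * dot a p.1 ^+ 2 + 2 * d ^+ 2 * dot a p.2 ^+ 2)))).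
  apply: mean_le.
  - exact: moments_norm (momentsB nA1 nA2).
  - by apply: momentsD => //; exact: momentsZ.
  move=> p; have Jp : 0 <= J (dot a p.1) by have /andP[] := uJ.2 (dot a p.1).
  have U0 : L p ^+ 2 <= 2 * (c - 1) ^+ 2 * dot a p.1 ^+ 2 + 2 * d ^+ 2 * dot a p.2 ^+ 2.
    rewrite /L; set x := (c - 1) * _; set y := d * _.
    have -> : 2 * (c - 1) ^+ 2 * dot a p.1 ^+ 2 + 2 * d ^+ 2 * dot a p.2 ^+ 2 = 2 * x ^+ 2 + 2 * y ^+ 2.
      by rewrite /x /y; ring.
    by have := sqr_ge0 (x - y); nra.
  have := le_trans (mulr_ge0 (ltW K0) (sqr_ge0 (L p))) (ler_wpM2l (ltW K0) U0).
  set U := K * (_ + _) => Up.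
  have diff : (dot p.1 a <= b) != (dot (lincomb c p.1 d p.2) a <= b) -> 1 <= J (dot a p.1) + U.
    have e2 : dot (lincomb c p.1 d p.2) a = dot a p.1 + L p.
      by rewrite dotC dot_lincomb /L; ring.
    rewrite e2 dotC => dif.
    have Lp : `|dot a p.1 - b| <= `|L p|.
      by case: (leP (dot a p.1) b) dif => h1; case: (leP (dot a p.1 + L p) b) => // h2 _;
        [rewrite ler0_norm ?subr_le0// (le_trans _ (ler_norm _))//; lra
        |rewrite gtr0_norm ?subr_gt0// -normrN (le_trans _ (ler_norm _))//; lra].
    have [hk|hk] := leP `|dot a p.1 - b| (k * r).
      rewrite /J indicE mem_set; first by rewrite lerDl.
      by move: hk; rewrite /= in_itv/= ler_norml => /andP[? ?]; apply/andP; split; lra.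
    have l1 : 1 <= K * L p ^+ 2.
      rewrite mulrC ler_pdivlMr ?mul1r ?exprn_gt0 ?mulr_gt0//.
      rewrite -[L p ^+ 2]real_normK ?num_real// lerXn2r ?nnegrE//.
        by rewrite mulr_ge0// ltW.
      exact: (le_trans (ltW hk)).
    have l2 : K * L p ^+ 2 <= U by rewrite ler_wpM2l// ltW.
    lra.
  rewrite !indicE.
  rewrite !mem_hspace; have [e2|ne] := eqVneq (dot p.1 a <= b) (dot (lincomb c p.1 d p.2) a <= b).
    by rewrite e2 subrr normr0 addr_ge0.
  apply: le_trans (diff ne).
  by case: (dot p.1 a <= b); case: (dot _ a <= b); rewrite ?subrr ?normr0 ?subr0 ?sub0r ?normrN ?normr1.
rewrite (meanD nJ (momentsZ K nU)) (meanZ K nU) (meanD (momentsZ (2 * (c - 1) ^+ 2) n12) (momentsZ (2 * d ^+ 2) n22)) !meanZ//.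
have nd2 : has_moments (G n) (fun x => dot a x ^+ 2) by apply: momentsX; exact: moments_dot.
rewrite (mean_fst (G n) nd2) (mean_snd (G n) nd2).
have m2 := mean_dot_sqr_le a; rewrite -r2 in m2.
rewrite (mean_fst (G n) (moments_unit (G n) uJd)).
have mJ : mean (G n) (fun x => J (dot a x)) <= 2 * k.
  rewrite (eqlaw_mean (eqlaw_dot a) uJ.1) -/r.
  rewrite (_ : (fun z => J (r * z)) = \1_(`[b / r - k, b / r + k]%classic)); last first.
    apply/funext => z; rewrite /J !indicE; congr ((_ : bool)%:R).
    have e1' : b - k * r = r * (b / r - k) by field; exact: lt0r_neq0.
    have e2' : b + k * r = r * (b / r + k) by field; exact: lt0r_neq0.
    apply/idP/idP => /set_mem /=; rewrite in_itv/= => z12; apply/mem_set;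
      by rewrite /= in_itv/=; move: z12; rewrite e1' e2' !ler_pM2l.
  rewrite -lee_fin mean_indic//; apply: le_trans (normal_itv_le _) _; first by lra.
  by rewrite lee_fin; lra.
have m0 : 0 <= mean (G n) (fun x => dot a x ^+ 2) by apply: mean_ge0 => x; exact: sqr_ge0.
set m := mean _ (fun x => dot a x ^+ 2) in m2 m0 *.
have s1 : 2 * (c - 1) ^+ 2 + 2 * d ^+ 2 = 4 * q.
  have -> : d ^+ 2 = 1 - c ^+ 2 by rewrite -cd; ring.
  by rewrite /c; ring.
have -> : 2 * (c - 1) ^+ 2 * m + 2 * d ^+ 2 * m = 4 * q * m by rewrite -mulrDl s1.
have : K * (4 * q * m) <= K * (4 * q * r ^+ 2).
  by rewrite ler_pM2l// ler_wpM2l// mulr_ge0// ltW.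
have -> : K * (4 * q * r ^+ 2) = e / 2.
  by rewrite /K /q; field; rewrite (gt_eqF rp) (gt_eqF k0).
move: mJ; rewrite /k; lra.
Qed.

End smoothing.

(** * From correlation with half-spaces to variance *)

Section correlation_gives_variance.
Context {R : realType}.
Local Notation G n := (gaussian R n).
Local Notation G2 n := (gaussian R n \x gaussian R n)%E.

(** Replacing g by its smoothing changes the covariance with 1_A by at most the
noise sensitivity of A, so a covariance of at least e / 2 remains; and the
covariance of a function with 1_A bounds its L^2 distance to any constant. *)
Lemma smooth_deviation_of_cov n (g : n.-tuple R -> R) (A : set (n.-tuple R)) (c d e m : R) :
  unit_fun g -> measurable A -> 0 <= c -> c ^+ 2 + d ^+ 2 = 1 -> 0 < e ->
  e < mean (G n) (fun x => \1_A x * g x) - mean (G n) \1_A * mean (G n) g ->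
  mean (G2 n) (fun p => `|\1_A p.1 - \1_A (lincomb c p.1 d p.2)|) <= e / 2 ->
  e ^+ 2 / 4 <= mean (G n) (fun x => (smooth c d g x - m) ^+ 2).
Proof.
move=> ug mA c0 cd e0 ecov estab.
have c1 : c != -1 by rewrite gt_eqF// (lt_le_trans _ c0)// oppr_lt0.
pose q := smooth c d g; have uq : unit_fun q by exact: unit_smooth.
have uA := unit_fun_indic (R := R) mA.
have lin := measurable_lincomb_pair (R := R) (n := n) c d.
have nA1 : has_moments (G2 n) (fun p => \1_A p.1) := moments_fst (G n) (moments_unit (G n) uA).
have uA2 := unit_fun_comp uA lin; have ug2 := unit_fun_comp ug lin.
have nA2 := moments_unit (G2 n) uA2; have ng2 := moments_unit (G2 n) ug2.
have nAg := momentsM (moments_unit (G n) uA) (moments_unit (G n) ug).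
have mlin x : measurable_fun setT (fun z : n.-tuple R => lincomb c x d z).
  by apply: measurable_fun_lincomb.
have exq : mean (G n) q = mean (G n) g.
  rewrite -(eqlaw_mean (eqlaw_lincomb (n := n) cd c1) ug.1).
  rewrite (mean_fubini (moments_unit (G2 n) ug2))// => x.
  by apply: moments_unit; exact: unit_fun_comp ug (mlin x).
have exAq : mean (G n) (fun x => \1_A x * q x) =
    mean (G2 n) (fun p => \1_A p.1 * g (lincomb c p.1 d p.2)).
  have nx x : has_moments (G n) (fun z => g (lincomb c x d z)).
    by apply: moments_unit; exact: unit_fun_comp ug (mlin x).
  rewrite (mean_fubini (momentsM nA1 ng2)) => [|x]; last exact: (momentsZ (\1_A x) (nx x)).
  by congr mean; apply/funext => x; rewrite (meanZ (\1_A x) (nx x)).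
have exAg : mean (G n) (fun x => \1_A x * g x) =
    mean (G2 n) (fun p => \1_A (lincomb c p.1 d p.2) * g (lincomb c p.1 d p.2)).
  by rewrite -(eqlaw_mean (eqlaw_lincomb (n := n) cd c1) (moments_measurable nAg)).
have nD := moments_norm (momentsB nA1 nA2).
have diff : mean (G n) (fun x => \1_A x * g x) - mean (G n) (fun x => \1_A x * q x) <= e / 2.
  apply: le_trans estab; rewrite exAq exAg -(meanB (momentsM nA2 ng2) (momentsM nA1 ng2)).
  apply: mean_le => // [|p]; first exact: momentsB (momentsM nA2 ng2) (momentsM nA1 ng2).
  rewrite -mulrBl; have /andP[g0 g1] := ug.2 (lincomb c p.1 d p.2).
  rewrite (le_trans (ler_norm _))// normrM distrC ler_piMr//.
  by rewrite ger0_norm.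
(* Centering q at m instead of at its own mean does not affect the covariance. *)
have nA := moments_unit (G n) uA; have nq := moments_unit (G n) uq.
have nqm : has_moments (G n) (fun x => q x - m) by apply: momentsB => //; exact: moments_cst.
have nqm2 := momentsX 2 nqm.
have a01 := mean_unit (G n) uA.
set a := mean (G n) \1_A in a01 ecov *.
have lb : e / 2 <= mean (G n) (fun x => (\1_A x - a) * (q x - m)).
  rewrite (_ : (fun x => _) = (fun x => (\1_A x * q x - a * q x) - (m * \1_A x - m * a))); last first.
    by apply/funext => x; ring.
  have n1 := momentsM nA nq; have n2 := momentsZ a nq; have n3 := momentsZ m nA.
  have n4 := moments_cst (G n) (m * a).
  rewrite (meanB (momentsB n1 n2) (momentsB n3 n4)) (meanB n1 n2) (meanB n3 n4) mean_cst !meanZ// exq -/a.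
  by lra.
have ub : mean (G n) (fun x => (\1_A x - a) * (q x - m)) <=
    mean (G n) (fun x => e^-1 * (q x - m) ^+ 2 + e / 4).
  apply: mean_le.
  - exact: (momentsM (momentsB nA (moments_cst (G n) a)) nqm).
  - by apply: momentsD; [exact: momentsZ|exact: moments_cst].
  move=> x; have /andP[A0 A1] := uA.2 x; have /andP[a0 a1] := a01.
  set y := q x - m.
  have b1 : (\1_A x - a) ^+ 2 <= 1 by nra.
  (* the AM-GM inequality with weights adapted to e *)
  have : 0 <= e^-1 * (y - (\1_A x - a) * (e / 2)) ^+ 2 by rewrite mulr_ge0 ?invr_ge0 ?sqr_ge0// ltW.
  have -> : e^-1 * (y - (\1_A x - a) * (e / 2)) ^+ 2 =
     e^-1 * y ^+ 2 - (\1_A x - a) * y + (\1_A x - a) ^+ 2 * (e / 4).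
    by field; exact: lt0r_neq0.
  have : (\1_A x - a) ^+ 2 * (e / 4) <= e / 4 by rewrite ler_piMl// divr_ge0// ltW.
  lra.
have := le_trans lb ub.
rewrite (meanD (momentsZ e^-1 nqm2) (moments_cst (G n) (e / 4))) mean_cst (meanZ _ nqm2).
set V := mean _ _ => h.
have : e / 4 <= e^-1 * V by lra.
rewrite -(ler_pM2l e0) mulVKf ?gt_eqF//.
by rewrite /V expr2; lra.
Qed.

(** The time u has exp(-2u) = s^2 c^2 + r^2, where c is the correlation of a noise
under which half-spaces are stable: applying that noise to the indicator of
B_{t,y} gives P_u 1_B evaluated at a point of the form al x + be y. *)
Lemma variance_of_correlated (t e : R) : 0 < t -> 0 < e ->
  exists u del : R, [/\ 0 < u, 0 < del & forall n (B : set (n.-tuple R)), measurable B ->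
    correlated_restrictions B t e -> (del%:E <= 'V_(G n)[ou_semigroup u \1_B])%E].
Proof.
move=> t0 e0; have [e1|e1] := ltP 1 e.
  exists 1, 1; split => // n B mB.
  rewrite /correlated_restrictions => h; exfalso.
  have : (e%:E <= 1%:E :> \bar R)%E.
    apply: (le_trans h); apply: probability_le1.
    exact: measurable_correlated.
  by rewrite lee_fin leNgt e1.
have [rt0 rt1 st0 rst] := ou_coef t0.
have e2p : 0 < e / 2 by rewrite divr_gt0.
have e4p : 0 < e / 4 by rewrite divr_gt0.
have [|c [d [c0 c1 d0 cd stab]]] := half_space_stable e4p; first by lra.
set r := expR (- t) in rt0 rt1 rst *; set s := Num.sqrt _ in st0 rst *.
pose ru2 := s ^+ 2 * c ^+ 2 + r ^+ 2.
have ru2E : ru2 = 1 - s ^+ 2 * d ^+ 2.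
  rewrite /ru2; have -> : r ^+ 2 = 1 - s ^+ 2 by rewrite -rst; ring.
  have -> : d ^+ 2 = 1 - c ^+ 2 by rewrite -cd; ring.
  by ring.
have sd0 : 0 < s * d by rewrite mulr_gt0.
have ru20 : 0 < ru2 by rewrite ltr_wpDl ?exprn_gt0// mulr_ge0// sqr_ge0.
have ru21 : ru2 < 1 by rewrite ru2E ltrBlDr ltrDl -exprMn exprn_gt0.
pose ru := Num.sqrt ru2.
have ru0 : 0 < ru by rewrite sqrtr_gt0.
have ruru : ru ^+ 2 = ru2 by rewrite sqr_sqrtr// ltW.
have ru1 : ru < 1 by rewrite -(@ltr_pXn2r _ 2)// ?nnegrE ?ltW// ruru expr1n.
pose u := - ln ru.
have u0 : 0 < u by rewrite oppr_gt0 ln_lt0// ru0.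
have eu : expR (- u) = ru by rewrite opprK lnK// posrE.
have su : Num.sqrt (1 - expR (- (2 * u))) = s * d.
  have -> : expR (- (2 * u)) = ru2 by rewrite -ruru -eu -expRM_natl; congr expR; ring.
  by rewrite ru2E opprB addrC subrK -exprMn sqrtr_sqr ger0_norm// ltW.
exists u, (e ^+ 3 / 16); split => //; first by rewrite divr_gt0// exprn_gt0.
move=> n B mB; rewrite /correlated_restrictions => hcorr.
have uB := unit_fun_indic (R := R) mB.
rewrite variance_ou// eu su; pose h := smooth ru (s * d) (\1_B : n.-tuple R -> R).
have uh : unit_fun h by exact: unit_smooth.
pose al := s * c / ru; pose be := r / ru.
have al0 : 0 <= al by rewrite divr_ge0 ?mulr_ge0// ltW.
have be0 : 0 <= be by rewrite divr_ge0// ltW.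
have ab : be ^+ 2 + al ^+ 2 = 1.
  by rewrite /al /be !expr_div_n -mulrDl ruru exprMn addrC divff// gt_eqF.
have be1 : be != -1 by rewrite gt_eqF// (lt_le_trans _ be0)// oppr_lt0.
pose m := mean (G n) h.
have m01 : 0 <= m <= 1 by exact: mean_unit.
have uhm := unit_sqr_dist uh m01.
have uhm2 := unit_fun_comp uhm (measurable_lincomb_pair (R := R) (n := n) be al).
pose V y := mean (G n) (fun x => (h (lincomb be y al x) - m) ^+ 2).
have uV : unit_fun V by exact: (unit_partial_mean (G n) (G n) uhm2).
have VE : mean (G n) V = gaussian_var h.
  rewrite /gaussian_var -/m -(eqlaw_mean (eqlaw_lincomb (n := n) ab be1) uhm.1).
  rewrite (mean_fubini (moments_unit (G2 n) uhm2))// => y.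
  rewrite /=; apply: moments_unit; apply: (unit_fun_comp uhm).
  by apply: measurable_fun_lincomb.
rewrite lee_fin -/h -VE.
set S := [set y | _] in hcorr.
have mS : measurable S by exact: measurable_correlated.
have key y : S y -> e ^+ 2 / 16 <= V y.
  move=> Sy.
  have /ereal_sup_gt[_ [A [a [b ->]] <-]] : ((e / 2)%:E < half_space_corr (restriction B t y))%E.
    by apply: lt_le_trans Sy; rewrite lte_fin; lra.
  have mBy := measurable_restriction mB t y.
  rewrite -/(hspace a b) covE//; last exact: measurable_hspace.
  rewrite lte_fin => cov2.
  have estab : mean (G2 n) (fun p => `|\1_(hspace a b) p.1 - \1_(hspace a b) (lincomb c p.1 d p.2)|) <= e / 2 / 2.
    by apply: (le_trans (stab n a b)); lra.
  have uBy := unit_fun_indic (R := R) mBy.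
  have := smooth_deviation_of_cov m uBy (@measurable_hspace R n a b) (ltW c0) cd e2p cov2 estab.
  rewrite (_ : (e / 2) ^+ 2 / 4 = e ^+ 2 / 16); last by field.
  rewrite (_ : (fun x => _) = (fun x => (h (lincomb be y al x) - m) ^+ 2))//.
  apply/funext => x; congr ((_ - _) ^+ 2).
  rewrite /h /smooth; congr mean; apply/funext => z; rewrite indic_restriction; congr (\1_B _).
  apply: eq_from_tnth => i; rewrite !tnth_lincomb -/r -/s /al /be.
  by field; exact: lt0r_neq0.
have := markov_bound (moments_unit (G n) uV) mS (fun y => (andP (uV.2 y)).1) _ key.
move=> /(_ (divr_ge0 (sqr_ge0 _) (ler0n _ 16))) h1.
have PS : e <= fine (G n S).
  by rewrite -lee_fin fineK// fin_num_measure.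
by apply: le_trans h1; rewrite exprSr mulrAC ler_wpM2l// divr_ge0// sqr_ge0.
Qed.

End correlation_gives_variance.

(** * Elementary estimates for limits and for rounding *)

Section elementary.
Context {R : realType}.
Implicit Types a b C : R.

Lemma le_of_le_add_inv a b C : (forall m : nat, a <= b + C / m.+1%:R) -> a <= b.
Proof.
move=> h; rewrite leNgt; apply/negP => ba.
have ab0 : 0 < a - b by rewrite subr_gt0.
have [C0|C0] := leP C 0.
  by have := h 0; have := ba; rewrite divr1; lra.
pose m := Num.truncn (C / (a - b)).
have : C / (a - b) < m.+1%:R by exact: truncnS_gt.
rewrite ltr_pdivrMr// => hm.
have m0 : 0 < m.+1%:R :> R by rewrite ltr0n.
have := h m; rewrite -lerBlDl ler_pdivlMr// mulrC; lra.
Qed.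

Lemma sqr_sum_le (N : nat) (a : nat -> R) :
  (\sum_(j < N) a j) ^+ 2 <= N%:R * \sum_(j < N) a j ^+ 2.
Proof.
elim: N => [|N IH]; first by rewrite !big_ord0 mul0r expr0n.
rewrite !big_ord_recr/=; set S := \sum_(j < N) a j in IH *.
set Q := \sum_(j < N) a j ^+ 2 in IH *; set x := a N.
rewrite -natr1; case: (posnP N) => [N0|N0].
  have S0 : S = 0 by rewrite /S N0 big_ord0.
  have Q0 : Q = 0 by rewrite /Q N0 big_ord0.
  by rewrite S0 Q0 N0 !add0r mul1r.
have n0 : 0 < N%:R :> R by rewrite ltr0n.
have h : 2 * S * x <= Q + N%:R * x ^+ 2.
  rewrite -(ler_pM2l n0); have := sqr_ge0 (S - N%:R * x).
  by rewrite sqrrB; move: IH; nra.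
by rewrite sqrrD; move: IH h; nra.
Qed.

(** The sum counts the positive integers up to the minimum of x and m. *)
Lemma count_le (m : nat) (x : R) : 0 <= x ->
  let s := \sum_(j < m) (j.+1%:R <= x :> R)%:R in
  [/\ s <= x, (x <= m%:R -> x - 1 <= s) & (m%:R <= x -> s = m%:R :> R)].
Proof.
move=> x0 /=; elim: m => [|m [IH1 IH2 IH3]].
  by rewrite big_ord0; split => //; lra.
rewrite big_ord_recr/=; have [mx|mx] := leP (m.+1%:R) x.
  have mx' : m%:R <= x by rewrite (le_trans _ mx)// ler_nat.
  by rewrite (IH3 mx') natr1; split => //; lra.
rewrite addr0; split => //.
move=> _; have [xm|xm] := leP x m%:R; first exact: IH2.
by rewrite (IH3 (ltW xm)); move: mx; rewrite -natr1; lra.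
Qed.

(** The value z clipped to [-1/2, 1/2] and rounded down to a grid of mesh 1/m,
written, up to the constant 1/2, as an average of indicators of half-lines. *)
Definition stair (m : nat) (z : R) : R :=
  - 2^-1 + m%:R^-1 * \sum_(j < m) (- 2^-1 + j.+1%:R / m%:R <= z)%R%:R.

(** Clipping at height 1/2 costs at most z^2 / 2, as z^2 - 2 |z| + 1 >= 0. *)
Lemma stair_le (m : nat) (z : R) : (0 < m)%N ->
  `|z - stair m z| <= m%:R^-1 + z ^+ 2 / 2.
Proof.
move=> m0; have mp : 0 < m%:R :> R by rewrite ltr0n.
have mi : 0 < (m%:R : R)^-1 by rewrite invr_gt0.
have z2 : 0 <= z ^+ 2 by exact: sqr_ge0.
have e : \sum_(j < m) (- 2^-1 + j.+1%:R / m%:R <= z)%R%:R =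
         \sum_(j < m) (j.+1%:R <= m%:R * (z + 2^-1))%R%:R :> R.
  apply: eq_bigr => j _; congr ((_ : bool)%:R).
  by rewrite -lerBrDl opprK ler_pdivrMr// mulrC.
have [zn|zp] := ltP (z + 2^-1) 0.
  have -> : stair m z = - 2^-1.
    rewrite /stair e big1 ?mulr0 ?addr0// => j _.
    have : m%:R * (z + 2^-1) < 0 by rewrite pmulr_rlt0.
    move=> h; case: leP => // h2; exfalso.
    by have := lt_le_trans h (ler0n _ j.+1); rewrite ltNge h2.
  rewrite ltr0_norm; last by lra.
  by have := sqr_ge0 (z + 1); rewrite sqrrD; lra.
have x0 : 0 <= m%:R * (z + 2^-1) by rewrite mulr_ge0.
have [s1 s2 s3] := count_le m x0.
rewrite /stair e; set s := \sum_(j < m) _ in s1 s2 s3 *.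
have [zh|zh] := leP (m%:R * (z + 2^-1)) m%:R.
  have t1 : m%:R^-1 * s <= z + 2^-1 by rewrite mulrC ler_pdivrMr// mulrC.
  have t2 : z + 2^-1 - m%:R^-1 <= m%:R^-1 * s.
    by rewrite -(ler_pM2l mp) mulVKf ?gt_eqF// mulrBr divff ?gt_eqF//; exact: s2.
  by rewrite ler_norml; apply/andP; split; lra.
rewrite (s3 (ltW zh)) mulVf ?gt_eqF//.
have : 1 < z + 2^-1 by move: zh; rewrite -[X in X < _]mulr1 ltr_pM2l.
move=> z1; rewrite gtr0_norm; last by lra.
by have := sqr_ge0 (z - 1); rewrite sqrrB; lra.
Qed.

End elementary.

(** * The barycenter of a set and its correlation with half-spaces *)

Section barycenters.
Context {R : realType}.
Local Notation G n := (gaussian R n).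
Local Notation G2 n := (gaussian R n \x gaussian R n)%E.

Definition barycenter n (g : n.-tuple R -> R) : n.-tuple R :=
  [tuple mean (G n) (fun x => tnth x i * g x) | i < n].

Lemma dot_barycenter n (g : n.-tuple R -> R) (v : n.-tuple R) : unit_fun g ->
  dot v (barycenter g) = mean (G n) (fun x => dot v x * g x).
Proof.
move=> ug; have ng := moments_unit (G n) ug.
have ni i : has_moments (G n) (fun x => tnth x i * g x) := momentsM (moments_tnth i) ng.
rewrite (_ : (fun x => _) = (fun x => \sum_(i < n) tnth v i * (tnth x i * g x))); last first.
  by apply/funext => x; rewrite /dot mulr_suml; apply: eq_bigr => i _; rewrite mulrA.
rewrite mean_sum => [|i]; last exact: momentsZ.
by apply: eq_bigr => i _; rewrite meanZ// tnth_mktuple.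
Qed.

(** With w the barycenter, |w|^2 = E <w, X> g(X) <= (E <w, X>^2 + 1) / 2, and the
second moment of <w, X> is at most |w|^2. *)
Lemma barycenter_le1 n (g : n.-tuple R -> R) : unit_fun g -> dot (barycenter g) (barycenter g) <= 1.
Proof.
move=> ug; have ng := moments_unit (G n) ug; set w := barycenter g.
have nw := moments_dot w; have nw2 := momentsX 2 nw.
have : dot w w <= mean (G n) (fun x => 2^-1 * dot w x ^+ 2 + 2^-1).
  rewrite {1}/w (dot_barycenter _ ug); apply: mean_le; first exact: momentsM.
    by apply: momentsD; [exact: momentsZ|exact: moments_cst].
  move=> x; have /andP[g0 g1] := ug.2 x.
  by have := sqr_ge0 (dot w x - g x); nra.
rewrite (meanD (momentsZ 2^-1 nw2) (moments_cst (G n) 2^-1)) mean_cst (meanZ _ nw2).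
by have := mean_dot_sqr_le w; lra.
Qed.

Lemma dot_sqr_le n (y w : n.-tuple R) : dot w w <= 1 -> dot y w ^+ 2 <= dot y y.
Proof.
move=> w1; have := dot_ge0 (lincomb 1 y (- dot y w) w).
rewrite dot_lincomb !(dotC (lincomb _ _ _ _)) !dot_lincomb (dotC w y).
by have := sqr_ge0 (dot y w); nra.
Qed.

(** The covariance of <w, X> with 1_C is |w|^2.  Replacing <w, X> by its staircase
gives an average of covariances with half-spaces, hence at most M, and by
[stair_le] the error is at most |w|^2 / 2 + 1/m. *)
Lemma barycenter_le_cov n (C : set (n.-tuple R)) (M : R) : measurable C ->
  (forall a b, cov (hspace a b) C <= M) ->
  let w := barycenter (\1_C) in dot w w <= 2 * M.
Proof.
move=> mC hM /=; set w := barycenter _; have uC := unit_fun_indic (R := R) mC.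
have nC := moments_unit (G n) uC; set mu := mean (G n) (\1_C).
have mu01 : 0 <= mu <= 1 := mean_unit (G n) uC.
have ww : dot w w = mean (G n) (fun x => dot w x * (\1_C x - mu)).
  rewrite {1}/w (dot_barycenter _ uC) (_ : (fun x => dot w x * (_ - _)) =
    (fun x => dot w x * \1_C x - mu * dot w x)); last by apply/funext => x; ring.
  rewrite (meanB (momentsM (moments_dot w) nC) (momentsZ mu (moments_dot w))).
  by rewrite (meanZ _ (moments_dot w)) mean_dot mulr0 subr0.
apply: (@le_of_le_add_inv _ _ _ 2) => k; set m := k.+1.
pose A j := hspace (lincomb (- 1) w 0 w) (2^-1 - j.+1%:R / m%:R).
have indA j x : (- 2^-1 + j.+1%:R / m%:R <= dot w x)%R%:R = \1_(A j) x :> R.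
  rewrite indicE mem_hspace dot_lincomb mulN1r mul0r addr0 (dotC x); congr ((_ : bool)%:R).
  by rewrite lerNl opprB; congr (_ <= _); ring.
have nA j : has_moments (G n) (\1_(A j) : _ -> R) by apply: moments_indic; exact: measurable_hspace.
pose S x := stair m (dot w x).
have SE x : S x = - 2^-1 + m%:R^-1 * \sum_(j < m) \1_(A j) x.
  by rewrite /S /stair; congr (_ + _ * _); apply: eq_bigr => j _; exact: indA.
have nsum : has_moments (G n) (fun x => \sum_(j < m) \1_(A j) x : R) by apply: moments_sum => j; exact: nA.
have nS : has_moments (G n) S.
  rewrite (funext SE); apply: momentsD; first exact: moments_cst.
  exact: momentsZ.
have nCm : has_moments (G n) (fun x => \1_C x - mu) by apply: momentsB => //; exact: moments_cst.
have exS : mean (G n) (fun x => S x * (\1_C x - mu)) <= M.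
  have nj j : has_moments (G n) (fun x => \1_(A j) x * (\1_C x - mu)) := momentsM (nA j) nCm.
  rewrite (_ : (fun x => _) = (fun x => - 2^-1 * (\1_C x - mu)
     + m%:R^-1 * \sum_(j < m) \1_(A j) x * (\1_C x - mu))); last first.
    by apply/funext => x; rewrite SE mulrDl -mulrA mulr_suml.
  have nsj : has_moments (G n) (fun x => \sum_(j < m) \1_(A j) x * (\1_C x - mu)).
    by apply: moments_sum => j; exact: nj.
  rewrite (meanD (momentsZ (- 2^-1) nCm) (momentsZ m%:R^-1 nsj)) (meanZ _ nCm) (meanZ _ nsj).
  rewrite (meanB nC (moments_cst (G n) mu)) mean_cst subrr mulr0 add0r.
  rewrite (mean_sum _ (F := fun (j : 'I_m) x => \1_(A j) x * (\1_C x - mu))); last by move=> j; exact: nj.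
  rewrite mulrC ler_pdivrMr ?ltr0n//.
  apply: (@le_trans _ _ (\sum_(j < m) M)); last by rewrite sumr_const card_ord mulr_natr.
  apply: ler_sum => j _.
  apply: le_trans (hM (lincomb (- 1) w 0 w) (2^-1 - j.+1%:R / m%:R)).
  rewrite -/(A j) /cov -/mu (_ : (fun x => _) = (fun x => \1_(A j) x * \1_C x - mu * \1_(A j) x)); last first.
    by apply/funext => x; ring.
  by rewrite (meanB (momentsM (nA j) nC) (momentsZ mu (nA j))) (meanZ _ (nA j)) (mulrC mu).
have nw2 := momentsX 2 (moments_dot w).
have exR : mean (G n) (fun x => (dot w x - S x) * (\1_C x - mu)) <= m%:R^-1 + dot w w / 2.
  have nU : has_moments (G n) (fun x => 2^-1 * dot w x ^+ 2) := momentsZ 2^-1 nw2.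
  have ncm := moments_cst (G n) (m%:R^-1 : R).
  apply: (@le_trans _ _ (mean (G n) (fun x => m%:R^-1 + 2^-1 * dot w x ^+ 2))).
    apply: mean_le.
    - by apply: momentsM => //; apply: momentsB => //; exact: moments_dot.
    - exact: momentsD ncm nU.
    move=> x; apply: le_trans (ler_norm _) _; rewrite normrM.
    have h1 : `|\1_C x - mu| <= 1.
      have /andP[? ?] := uC.2 x; have /andP[? ?] := mu01.
      by rewrite ler_norml; apply/andP; split; lra.
    apply: (@le_trans _ _ `|dot w x - S x|); first by rewrite ler_piMr.
    by have := stair_le (dot w x) (isT : (0 < m)%N); rewrite (mulrC 2^-1).
  rewrite (meanD ncm nU) mean_cst (meanZ _ nw2).
  by have := mean_dot_sqr_le w; lra.
have : dot w w <= M + (m%:R^-1 + dot w w / 2).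
  rewrite {1}ww (_ : (fun x => _) = (fun x => S x * (\1_C x - mu) + (dot w x - S x) * (\1_C x - mu))); last first.
    by apply/funext => x; ring.
  rewrite (meanD (momentsM nS nCm) (momentsM (momentsB (moments_dot w) nS) nCm)); exact: lerD.
lra.
Qed.

Lemma half_space_corr_ge_barycenter n (C : set (n.-tuple R)) : measurable C ->
  ((dot (barycenter \1_C) (barycenter \1_C) / 2)%:E <= half_space_corr C)%E.
Proof.
move=> mC; rewrite leNgt; apply/negP => hlt.
have lb a b : ((cov (hspace a b) C)%:E <= half_space_corr C)%E.
  apply: ereal_sup_ubound; exists (hspace a b); first exact: hspace_half_space.
  by rewrite covE//; exact: measurable_hspace.
have fin : half_space_corr C \is a fin_num.
  apply: fin_real; apply/andP; split; last exact: lt_le_trans hlt (leey _).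
  by apply: lt_le_trans (lb (barycenter \1_C) 0); rewrite ltNyr.
have h a b : cov (hspace a b) C <= fine (half_space_corr C) by rewrite -lee_fin fineK.
have /= h2 := barycenter_le_cov mC h.
by move: hlt; rewrite -{1}(fineK fin) lte_fin; lra.
Qed.

End barycenters.

(** * The Poincare inequality and the converse implication *)

Section variance_gives_correlation.
Context {R : realType}.
Local Notation G n := (gaussian R n).
Local Notation G2 n := (gaussian R n \x gaussian R n)%E.

Section one_function.
Variables (n : nat) (f : n.-tuple R -> R) (uf : unit_fun f).
Variables (r s : R) (s0 : 0 < s).

(* For f the indicator of B, g y is the indicator of the restriction B_{t,y} and
   kap *: w y is the gradient of h at y. *)
Let g (y x : n.-tuple R) : R := f (lincomb s x r y).
Let h : n.-tuple R -> R := smooth r s f.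
Let w (y : n.-tuple R) : n.-tuple R := barycenter (g y).
Let kap := r / s.

Let ug y : unit_fun (g y).
Proof. by apply: unit_fun_comp uf _; apply: measurable_fun_lincomb. Qed.

Let uh : unit_fun h. Proof. exact: unit_smooth. Qed.

Let hE y : h y = mean (G n) (g y).
Proof.
rewrite /h /smooth; congr mean; apply/funext => x; congr f.
by apply: eq_from_tnth => i; rewrite !tnth_lincomb addrC.
Qed.

Lemma measurable_barycenter : measurable_fun setT w.
Proof.
apply/measurable_fun_tnthP => i.
rewrite (_ : _ \o _ = fun y => mean (G n) (fun x => tnth x i * g y x)); last first.
  by apply/funext => y /=; rewrite tnth_mktuple.
have ug2 : unit_fun (fun p : n.-tuple R * n.-tuple R => g p.1 p.2).
  by apply: unit_fun_comp uf _; apply: measurable_fun_lincomb.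
have ni : has_moments (G2 n) (fun p => tnth p.2 i) := moments_snd (G n) (moments_tnth i).
exact: (measurable_partial_mean (momentsM ni (moments_unit (G2 n) ug2))).
Qed.

Lemma unit_barycenter : unit_fun (fun y => dot (w y) (w y)).
Proof.
split; first by apply: measurable_fun_dot; exact: measurable_barycenter.
by move=> y; rewrite dot_ge0 barycenter_le1.
Qed.

(** Moving y by de shifts x by v = kap de in g y x, and the Cameron-Martin formula
turns this shift into the factor tilt v x = 1 + <v, x> + O(|v|^2).  The linear
term contributes <v, w y>.  When |v| is not small, the bounds |h| <= 1 and
|w| <= 1 suffice. *)
Lemma smooth_increment (y de : n.-tuple R) :
  (h (lincomb 1 y 1 de) - h y) ^+ 2 <=
    2 * kap ^+ 2 * dot de (w y) ^+ 2 + 24 * kap ^+ 4 * dot de de ^+ 2.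
Proof.
pose v := lincomb kap de 0 de.
have vv : dot v v = kap ^+ 2 * dot de de.
  by rewrite dot_lincomb (dotC v) dot_lincomb; ring.
have vw : dot v (w y) = kap * dot de (w y).
  by rewrite dotC dot_lincomb (dotC de); ring.
have ngy := moments_unit (G n) (ug y); have nt := moments_tilt v; have nv := moments_dot v.
pose Rm x := tilt v x - 1 - dot v x.
have nRm : has_moments (G n) Rm by apply: momentsB => //; apply: momentsB => //; exact: moments_cst.
have shift : h (lincomb 1 y 1 de) = mean (G n) (fun x => g y x * tilt v x).
  rewrite hE -(mean_shift v (ug y).1 (fun x => (andP ((ug y).2 x)).1)).
  congr mean; apply/funext => x; congr f; apply: eq_from_tnth => i.
  rewrite !tnth_lincomb /kap; field; exact: lt0r_neq0.
have diff : h (lincomb 1 y 1 de) - h y = dot v (w y) + mean (G n) (fun x => g y x * Rm x).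
  rewrite shift hE (dot_barycenter _ (ug y)) -(meanD (momentsM nv ngy) (momentsM ngy nRm)).
  rewrite -(meanB (momentsM ngy nt) ngy); congr mean; apply/funext => x; rewrite /Rm; ring.
set D := h _ - h y in diff *; set L := dot v (w y) in diff vw.
have D1 : D ^+ 2 <= 1.
  have /andP[? ?] := uh.2 (lincomb 1 y 1 de); have /andP[? ?] := uh.2 y.
  by rewrite /D; nra.
have L2 : L ^+ 2 <= dot v v by apply: dot_sqr_le; exact: barycenter_le1.
have rem : (D - L) ^+ 2 <= 12 * dot v v ^+ 2.
  have [v1|v1] := leP (dot v v) 2^-1.
    rewrite diff addrC addKr.
    have ngR := momentsM ngy nRm.
    apply: (le_trans (mean_sqr_le ngR)).
    apply: (@le_trans _ _ (2 * dot v v ^+ 2)); last by rewrite ler_wpM2r ?sqr_ge0//; lra.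
    apply: le_trans (mean_remainder v1); apply: mean_le; try exact: momentsX.
    move=> x; rewrite exprMn ler_piMl ?sqr_ge0//.
    by have /andP[? ?] := (ug y).2 x; rewrite expr_le1.
  have v0 : 0 <= dot v v by exact: dot_ge0.
  have := sqr_ge0 (D + L); nra.
have : D ^+ 2 <= 2 * L ^+ 2 + 2 * (D - L) ^+ 2 by have := sqr_ge0 (D - 2 * L); nra.
rewrite vv in rem; rewrite {1}vw => hh; apply: (le_trans hh).
have -> : (kap * dot de (w y)) ^+ 2 = kap ^+ 2 * dot de (w y) ^+ 2 by ring.
have e4 : (kap ^+ 2 * dot de de) ^+ 2 = kap ^+ 4 * dot de de ^+ 2 by ring.
rewrite e4 in rem; lra.
Qed.

Let M2 := mean (G n) (fun x => dot x x).
Let M4 := mean (G n) (fun x => dot x x ^+ 2).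
Let W := mean (G n) (fun y => dot (w y) (w y)).

Lemma moments_rotation_increment c d : has_moments (G2 n) (fun p => (h (lincomb c p.1 d p.2) - h p.1) ^+ 2).
Proof.
apply: momentsX; apply: momentsB; apply: moments_unit.
- exact: unit_fun_comp uh (measurable_lincomb_pair c d).
- exact: unit_fun_comp uh measurable_fst.
Qed.

(** The leading term is of order eta^2 with a constant free of the dimension; the
moments M2 and M4 depend on n but come with the factor eta^4. *)
Lemma small_rotation (eta : R) : 0 <= eta <= 2 ->
  mean (G2 n) (fun p => (h (lincomb (cos eta) p.1 (sin eta) p.2) - h p.1) ^+ 2) <=
    4 * kap ^+ 2 * eta ^+ 2 * W + eta ^+ 4 * (kap ^+ 2 * M2 + 384 * kap ^+ 4 * M4).
Proof.
move=> /andP[eta0 eta2]; set c := cos eta; set d := sin eta.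
have [c0 c2] := andP (oneBcos_le eta); have d2 := sin_sqr_le eta.
rewrite -/c -/d in c0 c2 d2.
have eta4 : eta ^+ 2 <= 4.
  by have -> : 4 = 2 ^+ 2 :> R by [ring]; rewrite lerXn2r// nnegrE.
have c22 : (c - 1) ^+ 2 <= eta ^+ 4 / 4.
  have -> : (c - 1) ^+ 2 = (1 - c) ^+ 2 by ring.
  have -> : eta ^+ 4 / 4 = (eta ^+ 2 / 2) ^+ 2 by field.
  by rewrite lerXn2r// nnegrE (le_trans c0).
have e40 : 0 <= eta ^+ 4 by rewrite exprn_ge0.
have c44 : (c - 1) ^+ 4 <= eta ^+ 4.
  have -> : (c - 1) ^+ 4 = ((c - 1) ^+ 2) ^+ 2 by rewrite -exprM.
  apply: (@le_trans _ _ ((eta ^+ 4 / 4) ^+ 2)).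
    by rewrite lerXn2r// nnegrE ?sqr_ge0// divr_ge0.
  have -> : (eta ^+ 4 / 4) ^+ 2 = eta ^+ 4 * (eta ^+ 2 / 4) ^+ 2 by field.
  rewrite ler_piMr// expr_le1 ?divr_ge0 ?sqr_ge0//; lra.
have d44 : d ^+ 4 <= eta ^+ 4.
  have -> : d ^+ 4 = (d ^+ 2) ^+ 2 by rewrite -exprM.
  have -> : eta ^+ 4 = (eta ^+ 2) ^+ 2 by rewrite -exprM.
  by rewrite lerXn2r// nnegrE sqr_ge0.
pose X1 (p : n.-tuple R * n.-tuple R) := dot p.1 p.1.
pose X2 (p : n.-tuple R * n.-tuple R) := dot (w p.1) p.2 ^+ 2.
pose X3 (p : n.-tuple R * n.-tuple R) := dot p.1 p.1 ^+ 2.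
pose X4 (p : n.-tuple R * n.-tuple R) := dot p.2 p.2 ^+ 2.
have nd := @moments_dotself R n; have nd2 := momentsX 2 nd.
have nX1 : has_moments (G2 n) X1 := moments_fst (G n) nd.
have nX3 : has_moments (G2 n) X3 := moments_fst (G n) nd2.
have nX4 : has_moments (G2 n) X4 := moments_snd (G n) nd2.
have nX2 : has_moments (G2 n) X2.
  apply: (moments_le _ (moments_snd (G n) nd)) => [|p].
    apply: measurable_funX; apply: measurable_fun_dot => //.
    exact: (measurableT_comp measurable_barycenter).
  rewrite ger0_norm ?sqr_ge0// ger0_norm ?dot_ge0//.
  by rewrite /X2 dotC; apply: dot_sqr_le; exact: barycenter_le1.
pose U p := (4 * kap ^+ 2 * (c - 1) ^+ 2 * X1 p + 4 * kap ^+ 2 * d ^+ 2 * X2 p) +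
  (192 * kap ^+ 4 * (c - 1) ^+ 4 * X3 p + 192 * kap ^+ 4 * d ^+ 4 * X4 p).
have n1 := momentsZ (4 * kap ^+ 2 * (c - 1) ^+ 2) nX1.
have n2 := momentsZ (4 * kap ^+ 2 * d ^+ 2) nX2.
have n3 := momentsZ (192 * kap ^+ 4 * (c - 1) ^+ 4) nX3.
have n4 := momentsZ (192 * kap ^+ 4 * d ^+ 4) nX4.
have nU : has_moments (G2 n) U := momentsD (momentsD n1 n2) (momentsD n3 n4).
apply: (@le_trans _ _ (mean (G2 n) U)).
  apply: mean_le; [exact: moments_rotation_increment|exact: nU|move=> [y y'] /=].
  pose de := lincomb (c - 1) y d y'.
  have -> : lincomb c y d y' = lincomb 1 y 1 de.
    by apply: eq_from_tnth => i; rewrite !tnth_lincomb; ring.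
  apply: (le_trans (smooth_increment y de)).
  have dw : dot de (w y) ^+ 2 <= 2 * (c - 1) ^+ 2 * X1 (y, y') + 2 * d ^+ 2 * X2 (y, y').
    rewrite dotC dot_lincomb /X2 /X1/=.
    have yw : dot y (w y) ^+ 2 <= dot y y by apply: dot_sqr_le; exact: barycenter_le1.
    have := sqr_ge0 ((c - 1) * dot (w y) y - d * dot (w y) y').
    rewrite dotC in yw.
    have := ler_wpM2l (sqr_ge0 (c - 1)) yw; nra.
  have dd : dot de de ^+ 2 <= 8 * (c - 1) ^+ 4 * X3 (y, y') + 8 * d ^+ 4 * X4 (y, y').
    have dd1 : dot de de <= 2 * (c - 1) ^+ 2 * dot y y + 2 * d ^+ 2 * dot y' y'.
      have := dot_ge0 (lincomb (c - 1) y (- d) y').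
      rewrite !dot_lincomb !(dotC (lincomb _ _ _ _)) !dot_lincomb (dotC y' y); nra.
    have y0 := dot_ge0 y; have y0' := dot_ge0 y'; have de0 := dot_ge0 de.
    rewrite /X3 /X4/=.
    set a := (c - 1) ^+ 2 * dot y y; set b := d ^+ 2 * dot y' y'.
    have dd2 : dot de de <= 2 * a + 2 * b by move: dd1; rewrite /a /b; lra.
    have -> : 8 * (c - 1) ^+ 4 * dot y y ^+ 2 + 8 * d ^+ 4 * dot y' y' ^+ 2 = 8 * a ^+ 2 + 8 * b ^+ 2.
      by rewrite /a /b; ring.
    apply: (@le_trans _ _ ((2 * a + 2 * b) ^+ 2)).
      by rewrite lerXn2r// nnegrE (le_trans de0).
    by have := sqr_ge0 (a - b); nra.
  have k2 : 0 <= 2 * kap ^+ 2 by rewrite mulr_ge0// sqr_ge0.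
  have k4 : 0 <= 24 * kap ^+ 4 by rewrite mulr_ge0// exprn_even_ge0.
  apply: (le_trans (lerD (ler_wpM2l k2 dw) (ler_wpM2l k4 dd))).
  by rewrite /U; lra.
rewrite (meanD (momentsD n1 n2) (momentsD n3 n4)) (meanD n1 n2) (meanD n3 n4).
rewrite (meanZ _ nX1) (meanZ _ nX2) (meanZ _ nX3) (meanZ _ nX4).
have -> : mean (G2 n) X1 = M2 := mean_fst (G n) nd.
have -> : mean (G2 n) X3 = M4 := mean_fst (G n) nd2.
have -> : mean (G2 n) X4 = M4 := mean_snd (G n) nd2.
have X2W : mean (G2 n) X2 <= W.
  have nx y : has_moments (G n) (fun y' => X2 (y, y')) by exact: (momentsX 2 (moments_dot (w y))).
  rewrite (mean_fubini nX2 nx); apply: mean_le.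
  - apply: (@moments_bounded _ _ _ _ _ 1).
      exact: (measurable_partial_mean nX2).
    move=> y; rewrite ger0_norm; last by apply: mean_ge0 => z; exact: sqr_ge0.
    by apply: (le_trans (mean_dot_sqr_le (w y))); exact: barycenter_le1.
  - exact: (moments_unit (G n) unit_barycenter).
  - by move=> y; exact: (mean_dot_sqr_le (w y)).
have M20 : 0 <= M2 by apply: mean_ge0 => x; exact: dot_ge0.
have M40 : 0 <= M4 by apply: mean_ge0 => x; exact: sqr_ge0.
have W0 : 0 <= W by apply: mean_ge0 => x; exact: dot_ge0.
have k20 : 0 <= kap ^+ 2 by exact: sqr_ge0.
have k40 : 0 <= kap ^+ 4 by rewrite exprn_even_ge0.
have t1 : kap ^+ 2 * (c - 1) ^+ 2 * M2 <= kap ^+ 2 * (eta ^+ 4 / 4) * M2.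
  by rewrite ler_wpM2r// ler_wpM2l.
have t2 : kap ^+ 2 * d ^+ 2 * mean (G2 n) X2 <= kap ^+ 2 * eta ^+ 2 * W.
  apply: ler_pM => //.
  - by rewrite mulr_ge0// sqr_ge0.
  - by apply: mean_ge0 => p; exact: sqr_ge0.
  - by rewrite ler_wpM2l.
have t3 : kap ^+ 4 * (c - 1) ^+ 4 * M4 <= kap ^+ 4 * eta ^+ 4 * M4.
  by rewrite ler_wpM2r// ler_wpM2l.
have t4 : kap ^+ 4 * d ^+ 4 * M4 <= kap ^+ 4 * eta ^+ 4 * M4.
  by rewrite ler_wpM2r// ler_wpM2l.
lra.
Qed.

Lemma var_rotation : 2 * gaussian_var h = mean (G2 n) (fun p => (h p.2 - h p.1) ^+ 2).
Proof.
have nh := moments_unit (G n) uh; have nh2 := momentsX 2 nh.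
have n11 : has_moments (G2 n) (fun p => h p.1 ^+ 2) := moments_fst (G n) nh2.
have n22 : has_moments (G2 n) (fun p => h p.2 ^+ 2) := moments_snd (G n) nh2.
have n12 : has_moments (G2 n) (fun p => h p.1 * h p.2) := momentsM (moments_fst (G n) nh) (moments_snd (G n) nh).
rewrite (_ : (fun p => _) = (fun p => (h p.2 ^+ 2 + h p.1 ^+ 2) - 2 * (h p.1 * h p.2))); last first.
  by apply/funext => p; ring.
rewrite (meanB (momentsD n22 n11) (momentsZ 2 n12)) (meanD n22 n11) (meanZ _ n12).
rewrite (mean_fst (G n) nh2) (mean_snd (G n) nh2).
have -> : mean (G2 n) (fun p => h p.1 * h p.2) = mean (G n) h ^+ 2.
  rewrite (mean_fubini n12) => [|x]; last exact: (momentsZ (h x) nh).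
  rewrite (_ : (fun x => _) = (fun x => h x * mean (G n) h)) ?meanZr//.
  by apply/funext => x; rewrite /= (meanZ (h x) nh).
rewrite /gaussian_var; set m := mean (G n) h.
rewrite (_ : (fun x => _) = (fun x => (h x ^+ 2 - 2 * m * h x) + m ^+ 2)); last first.
  by apply/funext => x; ring.
rewrite (meanD (momentsB nh2 (momentsZ (2 * m) nh)) (moments_cst (G n) (m ^+ 2))) (meanB nh2 (momentsZ (2 * m) nh)).
by rewrite mean_cst (meanZ _ nh) -/m; ring.
Qed.

(** The quarter turn that carries Y to Y' is cut into N + 1 rotations of angle eta,
whose increments are identically distributed.  One factor N + 1 is their number,
the other comes from the Cauchy-Schwarz inequality. *)
Lemma rotation_step (N : nat) : let eta := pi / 2 / N.+1%:R in
  2 * gaussian_var h <= N.+1%:R ^+ 2 *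
    mean (G2 n) (fun p => (h (lincomb (cos eta) p.1 (sin eta) p.2) - h p.1) ^+ 2).
Proof.
set eta := _ / _ / _ => /=; set E := mean _ _.
have N0 : 0 < N.+1%:R :> R by rewrite ltr0n.
have eta0 : 0 < eta by rewrite divr_gt0// divr_gt0// pi_gt0.
have etaN : N.+1%:R * eta = pi / 2 by rewrite mulrC divfK// gt_eqF.
pose th (j : nat) : R := j%:R * eta.
pose F j (p : n.-tuple R * n.-tuple R) := h (lincomb (cos (th j)) p.1 (sin (th j)) p.2).
have uF j : unit_fun (F j) by exact: unit_fun_comp uh (measurable_lincomb_pair _ _).
have nF j := moments_unit (G2 n) (uF j).
have nD j := momentsX 2 (momentsB (nF j.+1) (nF j)).
have step j : (j < N.+1)%N -> mean (G2 n) (fun p => (F j.+1 p - F j p) ^+ 2) = E.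
  move=> jN.
  have cs : cos (th j) ^+ 2 + sin (th j) ^+ 2 = 1 by exact: cos2Dsin2.
  have c1 : cos (th j) != -1.
    have c0 : 0 < cos (th j).
      apply: cos_gt0_pihalf; apply/andP; split.
        by apply: (@lt_le_trans _ _ 0); rewrite ?oppr_lt0 ?divr_gt0 ?pi_gt0// mulr_ge0// ltW.
      by rewrite -etaN ltr_pM2r// ltr_nat.
    by rewrite gt_eqF// (lt_trans _ c0)// oppr_lt0.
  rewrite /E -(eqlaw_mean (eqlaw_rotation (n := n) cs c1) (moments_measurable (moments_rotation_increment (cos eta) (sin eta)))).
  congr mean; apply/funext => p /=; rewrite /F; congr ((h _ - _) ^+ 2).
  have -> : th j.+1 = eta + th j by rewrite /th -natr1; ring.
  by apply: eq_from_tnth => i; rewrite !tnth_lincomb cosD sinD; ring.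
rewrite var_rotation.
have F0 p : F 0 p = h p.1.
  rewrite /F /th mul0r cos0 sin0; congr h.
  by apply: eq_from_tnth => i; rewrite tnth_lincomb mul1r mul0r addr0.
have FN p : F N.+1 p = h p.2.
  rewrite /F /th etaN cos_pihalf sin_pihalf; congr h.
  by apply: eq_from_tnth => i; rewrite tnth_lincomb mul1r mul0r add0r.
have nsum : has_moments (G2 n) (fun p => \sum_(j < N.+1) (F j.+1 p - F j p) ^+ 2).
  by apply: moments_sum => j; exact: nD.
apply: (@le_trans _ _ (mean (G2 n) (fun p => N.+1%:R * \sum_(j < N.+1) (F j.+1 p - F j p) ^+ 2))).
  apply: mean_le.
  - apply: momentsX; apply: momentsB; first exact: moments_snd (moments_unit (G n) uh).
    exact: moments_fst (moments_unit (G n) uh).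
  - exact: momentsZ.
  move=> p; rewrite -FN -F0.
  have -> : F N.+1 p - F 0 p = \sum_(j < N.+1) (F j.+1 p - F j p).
    by rewrite -(telescope_sumr (fun j => F j p)) ?big_mkord.
  exact: (sqr_sum_le _ (fun j => F j.+1 p - F j p)).
rewrite (meanZ _ nsum) (mean_sum _ (F := fun (j : 'I_N.+1) p => (F j.+1 p - F j p) ^+ 2)); last by move=> j; exact: nD.
rewrite (eq_bigr (fun=> E)); last by move=> j _; exact: step.
by rewrite sumr_const card_ord -[E *+ _]mulr_natl mulrA -expr2.
Qed.

(** By [rotation_step] and [small_rotation], where (N + 1) eta = pi / 2 <= 2 and
the terms that depend on the dimension are O(1 / N). *)
Lemma gaussian_poincare : gaussian_var h <= 8 * kap ^+ 2 * W.
Proof.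
suff : 2 * gaussian_var h <= 16 * kap ^+ 2 * W by lra.
set C := kap ^+ 2 * M2 + 384 * kap ^+ 4 * M4.
have C0 : 0 <= C.
  apply: addr_ge0; first by rewrite mulr_ge0 ?sqr_ge0// mean_ge0// => x; exact: dot_ge0.
  have M40 : 0 <= M4 by apply: mean_ge0 => x; exact: sqr_ge0.
  have k40 : 0 <= kap ^+ 4 by rewrite exprn_even_ge0.
  exact: (mulr_ge0 (mulr_ge0 (ler0n R 384) k40) M40).
have W0 : 0 <= kap ^+ 2 * W by rewrite mulr_ge0 ?sqr_ge0// mean_ge0// => x; exact: dot_ge0.
apply: (@le_of_le_add_inv _ _ _ (16 * C)) => N.
have N0 : 0 < N.+1%:R :> R by rewrite ltr0n.
have N1 : 1 <= N.+1%:R :> R by rewrite ler1n.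
apply: (le_trans (rotation_step N)); set eta := _ / _ / _.
have p0 : 0 < pi / 2 :> R by rewrite divr_gt0// pi_gt0.
have p2 : pi / 2 < 2 :> R by exact: pihalf_lt2.
have eta0 : 0 <= eta <= 2.
  apply/andP; split; first by rewrite divr_ge0// ltW.
  rewrite ler_pdivrMr// (le_trans (ltW p2))//.
  by rewrite -[leLHS]mulr1 ler_wpM2l.
have eN : N.+1%:R * eta = pi / 2 by rewrite mulrC divfK// gt_eqF.
have eN2 : N.+1%:R ^+ 2 * eta ^+ 2 <= 4.
  by rewrite -exprMn eN; have -> : 4 = 2 ^+ 2 :> R by [ring]; rewrite lerXn2r// ?nnegrE ltW.
have e2 : eta ^+ 2 <= 4 / N.+1%:R.
  rewrite ler_pdivlMr//; apply: le_trans eN2; rewrite mulrC ler_wpM2r ?sqr_ge0//.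
  by rewrite expr2 ler_pMr.
have NN : 0 <= N.+1%:R ^+ 2 :> R by rewrite sqr_ge0.
apply: (le_trans (ler_wpM2l NN (small_rotation eta0))); rewrite -/C.
have -> : N.+1%:R ^+ 2 * (4 * kap ^+ 2 * eta ^+ 2 * W + eta ^+ 4 * C) =
   4 * (N.+1%:R ^+ 2 * eta ^+ 2) * (kap ^+ 2 * W) + (N.+1%:R ^+ 2 * eta ^+ 2) * (eta ^+ 2 * C).
  by ring.
have t1 : (N.+1%:R ^+ 2 * eta ^+ 2) * (kap ^+ 2 * W) <= 4 * (kap ^+ 2 * W) by rewrite ler_wpM2r.
have t2 : (N.+1%:R ^+ 2 * eta ^+ 2) * (eta ^+ 2 * C) <= 4 * (4 / N.+1%:R * C).
  have h1 : 0 <= N.+1%:R ^+ 2 * eta ^+ 2 := mulr_ge0 NN (sqr_ge0 eta).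
  have h2 : 0 <= eta ^+ 2 * C := mulr_ge0 (sqr_ge0 eta) C0.
  by apply: (ler_pM h1 h2 eN2); rewrite ler_wpM2r.
have -> : 16 * C / N.+1%:R = 4 * (4 / N.+1%:R * C) by field; rewrite gt_eqF.
have -> : 16 * kap ^+ 2 * W = 4 * (4 * (kap ^+ 2 * W)) by ring.
by apply: lerD => //; rewrite -[leLHS]mulrA ler_wpM2l.
Qed.

End one_function.

(** By the Poincare inequality E |w(Y)|^2 >= e0, and |w|^2 is at most 1 on the set
of correlated restrictions and at most 2 e off it; so that set has measure at
least e0 - 2 e = e. *)
Lemma correlated_of_variance (t del : R) : 0 < t -> 0 < del ->
  exists2 e : R, 0 < e & forall n (B : set (n.-tuple R)), measurable B ->
    (del%:E <= 'V_(G n)[ou_semigroup t \1_B])%E -> correlated_restrictions B t e.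
Proof.
move=> t0 del0; have [r0 r1 s0 rs] := ou_coef t0.
set r := expR (- t) in r0 r1 rs *; set s := Num.sqrt _ in s0 rs *.
have k0 : 0 < 8 * (r / s) ^+ 2 by rewrite mulr_gt0// exprn_gt0// divr_gt0.
pose e0 := del / (8 * (r / s) ^+ 2); pose e := e0 / 3.
have e00 : 0 < e0 by rewrite divr_gt0.
exists e; first by rewrite divr_gt0.
move=> n B mB; have uB := unit_fun_indic (R := R) mB.
rewrite variance_ou// lee_fin -/r -/s => hv.
have := le_trans hv (gaussian_poincare uB r s0).
rewrite mulrC -ler_pdivrMr// -/e0.
set W2 := fun y => _; rewrite /= => hW.
rewrite /correlated_restrictions; set S := [set y | _].
have mS : measurable S by exact: measurable_correlated.
have uW := unit_barycenter uB r s.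
have uS := unit_fun_indic (R := R) mS.
have nS := moments_unit (G n) uS.
have : mean (G n) W2 <= mean (G n) (fun y => \1_S y + 2 * e).
  apply: mean_le; [exact: moments_unit uW|by apply: momentsD => //; exact: moments_cst|move=> y].
  have [yS|yS] := pselect (S y).
    rewrite indicE mem_set//; have /andP[_ W1] := uW.2 y.
    by apply: (le_trans W1); rewrite lerDl mulr_ge0// divr_ge0// ltW.
  rewrite indicE memNset// add0r.
  have := half_space_corr_ge_barycenter (measurable_restriction mB t y) => hb.
  rewrite leNgt; apply/negP => h2; apply: yS; apply: le_trans hb.
  by rewrite lee_fin; move: h2; rewrite /W2 => h2; lra.
rewrite (meanD nS (moments_cst (G n) (2 * e))) mean_cst => h3.
rewrite -(fineK (fin_num_measure (G n) S mS)) lee_fin.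
have hS : mean (G n) \1_S = fine (G n S) := congr1 fine (mean_indic (G n) mS).
rewrite hS in h3; apply: le_trans (_ : e0 - 2 * e <= _); first by rewrite /e; lra.
by rewrite lerBlDr (le_trans hW).
Qed.

End variance_gives_correlation.

(** * Sequences of sets *)

Section sequences.
Context {R : realType}.

Definition ou_var n (t : R) (B : set (n.-tuple R)) : R :=
  gaussian_var (smooth (expR (- t)) (Num.sqrt (1 - expR (- (2 * t)))) (\1_B : n.-tuple R -> R)).

Lemma ou_varE n (t : R) (B : set (n.-tuple R)) : measurable B ->
  ('V_(gaussian R n)[ou_semigroup t \1_B] = (ou_var t B)%:E)%E.
Proof. by move=> mB; exact: (variance_ou t (unit_fun_indic (R := R) mB)). Qed.

Lemma ou_var_ge0 n (t : R) (B : set (n.-tuple R)) : 0 <= ou_var t B.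
Proof. by apply: mean_ge0 => x; exact: sqr_ge0. Qed.

Lemma ou_var_decr n (t u : R) (B : set (n.-tuple R)) : measurable B ->
  0 < u -> u <= t -> ou_var t B <= ou_var u B.
Proof.
move=> mB u0 ut; rewrite -lee_fin.
by have := ou_var_antitone (unit_fun_indic (R := R) mB) u0 ut; rewrite !ou_varE.
Qed.

Lemma noise_sensitiveP (n : nat -> nat) (B : forall i, set ((n i).-tuple R)) :
  (forall i, measurable (B i)) ->
  noise_sensitive B <-> forall t del : R, 0 < t -> 0 < del ->
    \forall i \near \oo, ou_var t (B i) < del.
Proof.
move=> mB.
have E t : (fun i => ('V_(gaussian R (n i))[ou_semigroup t \1_(B i)])%E) =
    EFin \o (fun i => ou_var t (B i)).
  by apply/funext => i; exact: ou_varE.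
split => [h t del t0 del0|h t t0].
  have := h t t0; rewrite E => /fine_cvg hc.
  exact: (cvgr_lt _ hc).
rewrite E; apply: cvg_EFin; first exact: nearW.
apply/cvgr0Pnorm_lt => del del0; have := h t del t0 del0; apply: filterS => i.
by rewrite ger0_norm ?ou_var_ge0.
Qed.

Lemma noise_stable_of_correlated (n : nat -> nat) (B : forall i, set ((n i).-tuple R))
  (t e : R) : (forall i, measurable (B i)) -> 0 < t -> 0 < e ->
  (forall k, exists2 i, (k <= i)%N & correlated_restrictions (B i) t e) ->
  noise_stable B.
Proof.
move=> mB t0 e0 h /(noise_sensitiveP mB) sensitive.
have [u [del [u0 del0 hA]]] := variance_of_correlated t0 e0.
have [k _ hk] := sensitive u del u0 del0.
have [i ki ci] := h k.
have := hA _ _ (mB i) ci; rewrite ou_varE// lee_fin leNgt.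
by rewrite hk.
Qed.

End sequences.

Theorem theorem1p3 (R : realType) (n : nat -> nat)
    (B : forall i : nat, set ((n i).-tuple R))
    (n_gt0 : forall i, (0 < n i)%N)
    (mB : forall i, measurable (B i)) :
  ((forall phi : nat -> nat, {homo phi : i j / (i < j)%N} ->
      noise_stable (fun i => B (phi i))) <->
   exists t e : R, [/\ 0 < t, 0 < e &
     \forall i \near \oo, correlated_restrictions (B i) t e])
  /\
  (noise_stable B <->
   exists t e : R, [/\ 0 < t, 0 < e &
     forall k : nat, exists2 i, (k <= i)%N & correlated_restrictions (B i) t e]).
Proof.
split; split.
(* If no pair (t, e) works for all large i, some B i with i arbitrarily large have
   variance below 1 / (j + 1) at time 1 / (j + 1), hence at all later times. *)
- move=> stable; apply: contrapT => none.
  have small (j k : nat) : exists i, (k <= i)%N /\ ou_var j.+1%:R^-1 (B i) < j.+1%:R^-1 :> R.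
    apply: contrapT => big.
    have d0 : 0 < j.+1%:R^-1 :> R by rewrite invr_gt0.
    have [e e0 he] := correlated_of_variance d0 d0.
    apply: none; exists j.+1%:R^-1, e; split => //.
    exists k => // i /= ki; apply: he => //.
    by rewrite ou_varE// lee_fin leNgt; apply/negP => hi; apply: big; exists i.
  have /choice[next nextP] : forall jk : nat * nat, exists i,
      (jk.2 <= i)%N /\ ou_var jk.1.+1%:R^-1 (B i) < jk.1.+1%:R^-1 :> R.
    by move=> [j k]; exact: small.
  pose phi := fix phi j := if j is j'.+1 then next (j, (phi j').+1) else next (0, 0)%N.
  have phi_incr : {homo phi : i j / (i < j)%N}.
    apply: (homo_ltn (fun y x z : nat => @ltn_trans y x z)) => j.
    by have [] := nextP (j.+1, (phi j).+1).
  have phi_small j : ou_var j.+1%:R^-1 (B (phi j)) < j.+1%:R^-1 :> R.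
    by case: j => [|j]; [have [] := nextP (0, 0)%N|have [] := nextP (j.+1, (phi j).+1)].
  apply: (stable phi phi_incr); apply/(noise_sensitiveP (fun j => mB (phi j))).
  move=> t del t0 del0.
  near=> j.
  apply: (@le_lt_trans _ _ (ou_var j.+1%:R^-1 (B (phi j)))).
    apply: ou_var_decr => //.
    by apply: ltW; near: j; exact: (near_infty_natSinv_lt (PosNum t0)).
  apply: (lt_trans (phi_small j)).
  by near: j; exact: (near_infty_natSinv_lt (PosNum del0)).
- move=> [t [e [t0 e0 [k0 _ hk0]]]] phi phi_incr.
  apply: (noise_stable_of_correlated (fun i => mB (phi i)) t0 e0) => k.
  have phi_ge i : (i <= phi i)%N.
    by elim: i => // i IH; apply: leq_ltn_trans IH _; exact: phi_incr.
  exists (maxn k k0); first exact: leq_maxl.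
  by apply: hk0 => /=; apply: leq_trans (phi_ge _); exact: leq_maxr.
- move=> stable; apply: contrapT => none; apply: stable.
  apply/(noise_sensitiveP mB) => t del t0 del0.
  have [e e0 he] := correlated_of_variance t0 del0.
  have /existsNP[k hk] : ~ (forall k : nat, exists2 i, (k <= i)%N & correlated_restrictions (B i) t e).
    by move=> h; apply: none; exists t, e.
  exists k => // i /= ki; rewrite ltNge; apply/negP => hi; apply: hk; exists i => //.
  by apply: he => //; rewrite ou_varE// lee_fin.
- by move=> [t [e [t0 e0 h]]]; exact: noise_stable_of_correlated h.
Unshelve. all: by end_near. Qed.
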